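(* Let $T>0$. Let $a:[0,\infty)\to[0,\infty)$ be a continuous function with $a(0)=0$ and $a(\eta)>0$ for $\eta>0$, let $f:([0,\infty)\times\mathbb{R}^3)^2\to\mathbb{C}$ be a bounded function, and set $$\widetilde K(\eta_1,\mathbf{x}_1,\eta_2,\mathbf{x}_2)=\frac{f(\eta_1,\mathbf{x}_1,\eta_2,\mathbf{x}_2)}{|\mathbf{x}_1-\mathbf{x}_2|}.$$ Let $\lambda\in\mathbb{C}$ be an arbitrary constant. Consider the integral equation for $\psi(\eta_1,\mathbf{x}_1,\eta_2,\mathbf{x}_2)$, $\eta_1,\eta_2\in[0,T]$, $\mathbf{x}_1,\mathbf{x}_2\in\mathbb{R}^3$: $$\psi(\eta_1,\mathbf{x}_1,\eta_2,\mathbf{x}_2)=\psi^{\rm free}(\eta_1,\mathbf{x}_1,\eta_2,\mathbf{x}_2)+\frac{\lambda}{(4\pi)^2}\frac{1}{a(\eta_1)a(\eta_2)}\int_{\mathbb{R}^3}\!d^3\mathbf{x}_1'\int_{\mathbb{R}^3}\!d^3\mathbf{x}_2'\;a^2(\eta_1-|\mathbf{x}_1-\mathbf{x}_1'|)\,a^2(\eta_2-|\mathbf{x}_2-\mathbf{x}_2'|)\,\frac{H(\eta_1-|\mathbf{x}_1-\mathbf{x}_1'|)}{|\mathbf{x}_1-\mathbf{x}_1'|}\,\frac{H(\eta_2-|\mathbf{x}_2-\mathbf{x}_2'|)}{|\mathbf{x}_2-\mathbf{x}_2'|}\,\widetilde K(\eta_1-|\mathbf{x}_1-\mathbf{x}_1'|,\mathbf{x}_1',\eta_2-|\mathbf{x}_2-\mathbf{x}_2'|,\mathbf{x}_2')\,\psi(\eta_1-|\mathbf{x}_1-\mathbf{x}_1'|,\mathbf{x}_1',\eta_2-|\mathbf{x}_2-\mathbf{x}_2'|,\mathbf{x}_2'),$$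 where the integrand is understood to be zero whenever one of the Heaviside factors vanishes. Then for every $\psi^{\rm free}$ with $a(\eta_1)a(\eta_2)\psi^{\rm free}\in\mathscr{B}_3$, this equation has a unique solution $\psi$ with $a(\eta_1)a(\eta_2)\psi\in\mathscr{B}_3$.
   Context: $H$ denotes the Heaviside function. $\mathscr{B}_3:=L^\infty\big([0,T]^2_{(\eta_1,\eta_2)},L^2(\mathbb{R}^{6}_{(\mathbf{x}_1,\mathbf{x}_2)})\big)$ is the Banach space with norm $\|\psi\|_{\mathscr{B}_3}=\operatorname{ess\,sup}_{\eta_1,\eta_2\in[0,T]}\|\psi(\eta_1,\cdot,\eta_2,\cdot)\|_{L^2(\mathbb{R}^{6})}$.
   Formalization: The function f is additionally assumed (Borel) measurable on ([0,∞)×R³)²; for a merely bounded, non-measurable f the integral in the equation need not be defined. *)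

(* Defs.v *)
From HB Require Import structures.
From mathcomp Require Import all_boot all_order all_algebra.
From mathcomp Require Import all_classical all_reals all_analysis.
From mathcomp.real_closed Require Import complex.
Set Implicit Arguments. Unset Strict Implicit. Unset Printing Implicit Defensive.
Import Order.TTheory GRing.Theory Num.Theory.
Import numFieldNormedType.Exports.
Local Open Scope classical_set_scope.
Local Open Scope ring_scope.

Section Defs.
Context {R : realType}.

Definition R3 := (R * R * R)%type.

Definition leb2 := (@lebesgue_measure R \x @lebesgue_measure R)%E.
Definition leb3 := ((@lebesgue_measure R \x @lebesgue_measure R) \x @lebesgue_measure R)%E.
Definition leb6 := (leb3 \x leb3)%E.

Definition dist3 (x y : R3) : R :=
  Num.sqrt ((x.1.1 - y.1.1) ^+ 2 + (x.1.2 - y.1.2) ^+ 2 + (x.2 - y.2) ^+ 2).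

(** Heaviside function (the value at 0 is irrelevant: a null set). *)
Definition heaviside (t : R) : R := if 0 <= t then 1 else 0.

Definition cmod (z : R[i]) : R := Num.sqrt (complex.Re z ^+ 2 + complex.Im z ^+ 2).

Definition cmeasurable {d} {X : measurableType d} (D : set X) (g : X -> R[i]) :=
  measurable_fun D (fun x => complex.Re (g x)) /\ measurable_fun D (fun x => complex.Im (g x)).

Definition cintegrable {d} {X : measurableType d} (mu : set X -> \bar R) (g : X -> R[i]) :=
  mu.-integrable setT (fun x => (complex.Re (g x))%:E) /\
  mu.-integrable setT (fun x => (complex.Im (g x))%:E).

Definition cintegral {d} {X : measurableType d} (mu : set X -> \bar R) (g : X -> R[i]) : R[i] :=
  (fine (\int[mu]_x (complex.Re (g x))%:E) +i* fine (\int[mu]_x (complex.Im (g x))%:E))%C.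

Definition fn4 := R -> R3 -> R -> R3 -> R[i].

Definition uncurry4 (g : fn4) : (R * R) * (R3 * R3) -> R[i] :=
  fun p => g p.1.1 p.2.1 p.1.2 p.2.2.

Definition weighted (a : R -> R) (g : fn4) : fn4 :=
  fun e1 x1 e2 x2 => ((a e1 * a e2)%:C * g e1 x1 e2 x2)%C.

(** Membership in B_3 = L^oo([0,T]^2, L^2(R^6)): jointly measurable on
    [0,T]^2 x R^6, and ess sup over (eta1,eta2) in [0,T]^2 of the L^2(R^6)-norm
    is finite (i.e. the squared L^2 norm is a.e. bounded by some constant). *)
Definition inB3 (T : R) (g : fn4) : Prop :=
  cmeasurable ((`[0, T] `*` `[0, T]) `*` setT) (uncurry4 g) /\
  exists M : R, {ae leb2, forall e : R * R, e.1 \in `[0, T] -> e.2 \in `[0, T] ->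
     (\int[leb6]_x ((cmod (g e.1 x.1 e.2 x.2)) ^+ 2)%:E <= M%:E)%E}.

Definition Ktilde (f : fn4) : fn4 :=
  fun e1 x1 e2 x2 => (f e1 x1 e2 x2 / (dist3 x1 x2)%:C)%C.

Definition integrand (a : R -> R) (f psi : fn4) (e1 : R) (x1 : R3) (e2 : R) (x2 : R3)
    : R3 * R3 -> R[i] :=
  fun y =>
    let r1 := dist3 x1 y.1 in let r2 := dist3 x2 y.2 in
    let s1 := e1 - r1 in let s2 := e2 - r2 in
    ((a s1 ^+ 2 * a s2 ^+ 2 * (heaviside s1 / r1) * (heaviside s2 / r2))%:C
       * Ktilde f s1 y.1 s2 y.2 * psi s1 y.1 s2 y.2)%C.

Definition solves (T : R) (lam : R[i]) (a : R -> R) (f psifree psi : fn4) : Prop :=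
  {ae leb2, forall e : R * R, e.1 \in `[0, T] -> e.2 \in `[0, T] ->
    {ae leb6, forall x : R3 * R3,
       cintegrable leb6 (integrand a f psi e.1 x.1 e.2 x.2) /\
       psi e.1 x.1 e.2 x.2 =
         (psifree e.1 x.1 e.2 x.2
          + lam * (((4 * pi) ^+ 2)^-1 * (a e.1 * a e.2)^-1)%:C
              * cintegral leb6 (integrand a f psi e.1 x.1 e.2 x.2))%C}}.

End Defs.

(* Main.v *)
(** Multiplying the equation by [a e1 * a e2] turns it into [phi = phi0 + c K phi],
    where [K] carries, up to a constant, the kernel
    1 / (|x1-y1| |x2-y2| |y1-y2|) and reads [phi] at the retarded times.
    Cauchy-Schwarz, with 1/|z|^2 integrable near the origin of R^3, bounds the
    squared L^2-norm N(e) of [K phi] at times [e] by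
    C * \int |z1|^-2 |z2|^-2 N(e1-|z1|, e2-|z2|) dz over |z1|, |z2| <= T.
    In the norm weighted by exp(-g (e1+e2)) the constant becomes
    C * \int |z1|^-2 |z2|^-2 exp(-g (|z1|+|z2|)) dz, which tends to 0 as g grows.
    Uniqueness is then immediate.  For existence, the real and imaginary parts
    are split into positive and negative parts, which gives a system with
    nonnegative kernels; its Picard iterates increase, so monotone convergence
    yields the solution. *)
From HB Require Import structures.
From mathcomp Require Import all_boot all_order all_algebra.
From mathcomp Require Import all_classical all_reals all_analysis.
From mathcomp.real_closed Require Import complex.
From mathcomp Require Import measurable_realfun ring lra.
Require Import Defs.
Import Order.TTheory GRing.Theory Num.Theory.
Import numFieldNormedType.Exports.
Local Open Scope classical_set_scope.
Local Open Scope ring_scope.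
Set Implicit Arguments.
Unset Strict Implicit.
Unset Printing Implicit Defensive.

(** Since [a^2 psi = a (a psi)], one factor [a] at each retarded time is absorbed by [phi]; the
    other is bounded on [0,T] by continuity, and the prefactor 1/(a a) cancels, so no singularity in
    time remains. The obstacle is null sets of times. The equation and the B_3 bound hold for almost
    every pair of times only, whereas the integral at one pair reads [phi] at all earlier pairs on
    the light cones. For existence the datum is set to zero at its exceptional times, after which
    every norm estimate holds at every pair. For uniqueness the difference of two solutions is given
    and cannot be altered; its size is therefore measured by the integral over all times of exp(-g
    (e1+e2)) N(e). That integral ignores null sets, and retardation by a fixed z acts on it as a
    translation. Functions with values in [0,+oo] make each integral and each iterate meaningful
    before anything is known to be finite, and a monotone limit of jointly measurable iterates is
    again jointly measurable. *)

Section nonneg_measurable.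
Local Open Scope ereal_scope.
Context {R : realType}.

(** * Nonnegative measurable functions, Tonelli and Cauchy-Schwarz *)

Definition mnn (d : measure_display) (X : measurableType d) (f : X -> \bar R) :=
  measurable_fun setT f /\ forall x, 0 <= f x.

Lemma mnn_comp (d d' : measure_display) (X : measurableType d) (Y : measurableType d')
    (f : Y -> \bar R) (h : X -> Y) :
  measurable_fun setT h -> mnn f -> mnn (fun x => f (h x)).
Proof. by move=> mh [mf f0]; split=> [|x]; [exact: measurableT_comp|]. Qed.

Lemma mnn_pair1 (d d' : measure_display) (X : measurableType d) (Y : measurableType d')
    (f : X * Y -> \bar R) x : mnn f -> mnn (fun y => f (x, y)).
Proof. by apply: mnn_comp; exact: pair1_measurable. Qed.

Lemma mnn_pair2 (d d' : measure_display) (X : measurableType d) (Y : measurableType d')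
    (f : X * Y -> \bar R) y : mnn f -> mnn (fun x => f (x, y)).
Proof. by apply: mnn_comp; exact: pair2_measurable. Qed.

Lemma mnnD (d : measure_display) (X : measurableType d) (f g : X -> \bar R) :
  mnn f -> mnn g -> mnn (fun x => f x + g x).
Proof.
move=> [mf f0] [mg g0]; split=> [|x]; last exact: adde_ge0.
exact: emeasurable_funD.
Qed.

Lemma mnnM (d : measure_display) (X : measurableType d) (f g : X -> \bar R) :
  mnn f -> mnn g -> mnn (fun x => f x * g x).
Proof.
move=> [mf f0] [mg g0]; split=> [|x]; last exact: mule_ge0.
exact: emeasurable_funM.
Qed.

Lemma mnn_cst (d : measure_display) (X : measurableType d) (c : \bar R) :
  0 <= c -> mnn (fun _ : X => c).
Proof. by split. Qed.

Lemma mnn_EFin (d : measure_display) (X : measurableType d) (f : X -> R) :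
  measurable_fun setT f -> (forall x, 0 <= f x)%R -> mnn (fun x => (f x)%:E).
Proof. by move=> mf f0; split=> [|x]; [exact/measurable_EFinP|rewrite lee_fin]. Qed.

Lemma mnn_sum (d : measure_display) (X : measurableType d) (I : Type) (s : seq I)
    (f : I -> X -> \bar R) :
  (forall i, mnn (f i)) -> mnn (fun x => \sum_(i <- s) f i x).
Proof.
move=> mf; split=> [|x].
  by apply: emeasurable_sum => i; case: (mf i).
by apply: sume_ge0 => i _; case: (mf i).
Qed.

Lemma mnn_integral (d d' : measure_display) (X : measurableType d) (Y : measurableType d')
    (m : {sigma_finite_measure set Y -> \bar R}) (f : X * Y -> \bar R) :
  mnn f -> mnn (fun x => \int[m]_y f (x, y)).
Proof.
move=> [mf f0]; split=> [|x]; last by apply: integral_ge0 => y _.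
exact: (@measurable_fun_fubini_tonelli_F _ _ _ _ R m).
Qed.

Lemma mnn_integral_le (d : measure_display) (X : measurableType d)
    (m : {measure set X -> \bar R}) (f g : X -> \bar R) :
  mnn f -> mnn g -> (forall x, f x <= g x) -> \int[m]_x f x <= \int[m]_x g x.
Proof.
by move=> [mf f0] [mg g0] fg; apply: ge0_le_integral => //.
Qed.

Lemma mnn_integral_ae_le (d : measure_display) (X : measurableType d)
    (m : {measure set X -> \bar R}) (f g : X -> \bar R) :
  mnn f -> mnn g -> {ae m, forall x, f x <= g x} ->
  \int[m]_x f x <= \int[m]_x g x.
Proof.
move=> [mf f0] [mg g0] fg; apply: ae_ge0_le_integral => //.
by apply: filterS fg => x.
Qed.

Lemma mnn_integralZl (d : measure_display) (X : measurableType d)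
    (m : {measure set X -> \bar R}) (f : X -> \bar R) c :
  mnn f -> 0 <= c -> \int[m]_x (c * f x) = c * \int[m]_x f x.
Proof. by move=> [mf f0] c0; rewrite ge0_integralZl. Qed.

Lemma mnn_integralD (d : measure_display) (X : measurableType d)
    (m : {measure set X -> \bar R}) (f g : X -> \bar R) :
  mnn f -> mnn g ->
  \int[m]_x (f x + g x) = \int[m]_x f x + \int[m]_x g x.
Proof. by move=> [mf f0] [mg g0]; rewrite ge0_integralD. Qed.

Lemma mnn_tonelli (d d' : measure_display) (X : measurableType d) (Y : measurableType d')
    (m1 : {sigma_finite_measure set X -> \bar R})
    (m2 : {sigma_finite_measure set Y -> \bar R}) (f : X * Y -> \bar R) :
  mnn f -> \int[m1]_x \int[m2]_y f (x, y) = \int[m2]_y \int[m1]_x f (x, y).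
Proof. by move=> [mf f0]; rewrite fubini_tonelli. Qed.

Lemma mnn_integral_prod (d d' : measure_display) (X : measurableType d)
    (Y : measurableType d')
    (m1 : {sigma_finite_measure set X -> \bar R})
    (m2 : {sigma_finite_measure set Y -> \bar R}) (f : X * Y -> \bar R) :
  mnn f -> \int[m1 \x m2]_z f z = \int[m1]_x \int[m2]_y f (x, y).
Proof. by move=> [mf f0]; rewrite fubini_tonelli1. Qed.

Lemma mnn_integral_eq0 (d : measure_display) (X : measurableType d)
    (m : {measure set X -> \bar R}) (f : X -> \bar R) :
  mnn f -> \int[m]_x f x = 0 -> {ae m, forall x, f x = 0}.
Proof.
move=> [mf f0] If.
have /ae_eq_integral_abs : \int[m]_x `|f x| = 0.
  by rewrite -If; apply: eq_integral => x _; rewrite gee0_abs.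
by move=> /(_ measurableT mf); apply: filterS => x /(_ I).
Qed.

Lemma mnn_integral_lty (d : measure_display) (X : measurableType d)
    (m : {measure set X -> \bar R}) (f : X -> \bar R) :
  mnn f -> \int[m]_x f x < +oo -> {ae m, forall x, f x < +oo}.
Proof.
move=> [mf f0] If.
have : m.-integrable setT f.
  apply/integrableP; split=> //.
  rewrite (_ : \int[m]_x `|f x| = \int[m]_x f x)//.
  by apply: eq_integral => x _; rewrite gee0_abs.
move=> /(integrable_ae measurableT); apply: filterS => x /(_ I).
by rewrite ge0_fin_numE.
Qed.

Lemma ae_imp (d : measure_display) (X : measurableType d)
    (m : {measure set X -> \bar R}) (P Q : X -> Prop) :
  (forall x, P x -> Q x) -> {ae m, forall x, P x} -> {ae m, forall x, Q x}.
Proof. by move=> PQ; apply: filterS. Qed.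

Lemma ae_imp2 (d : measure_display) (X : measurableType d)
    (m : {measure set X -> \bar R}) (P1 P2 Q : X -> Prop) :
  (forall x, P1 x -> P2 x -> Q x) -> {ae m, forall x, P1 x} ->
  {ae m, forall x, P2 x} -> {ae m, forall x, Q x}.
Proof. by move=> PQ; apply: filterS2. Qed.

Lemma mule2_le_sqr (x y : \bar R) : 0 <= x -> 0 <= y ->
  2%:E * (x * y) <= x * x + y * y.
Proof.
case: x => [x||]//; case: y => [y||]// x0 y0.
- rewrite -!EFinM -EFinD lee_fin; have := sqr_ge0 (x - y)%R; nra.
- by rewrite mulyy addey ?leey // -EFinM.
- by rewrite mulyy addye ?leey // -EFinM.
- by rewrite !mulyy addye // leey.
Qed.

(** Integrating 2t uv <= t^2 u^2 + v^2 gives 2t I <= t^2 K + V for all t >= 0, and t = I/K is the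
    best choice. The form with a real bound [K] and squares avoids roots of extended reals. *)
Lemma integral_cauchy_schwarz (d : measure_display) (X : measurableType d)
    (m : {measure set X -> \bar R}) (u v : X -> \bar R) (K : R) :
  mnn u -> mnn v -> (0 < K)%R -> \int[m]_x (u x * u x) <= K%:E ->
  (\int[m]_x (u x * v x)) * (\int[m]_x (u x * v x))
    <= K%:E * \int[m]_x (v x * v x).
Proof.
move=> mu mv K0 uK.
have u0 := mu.2; have v0 := mv.2.
set I := \int[m]_x (u x * v x).
have I0 : 0 <= I by apply: integral_ge0 => x _; exact: mule_ge0.
have V0 : 0 <= \int[m]_x (v x * v x) by apply: integral_ge0 => x _; exact: mule_ge0.
have muv := mnnM mu mv.
have key (t : R) : (0 <= t)%R ->
    (2 * t)%:E * I <= (t * t)%:E * K%:E + \int[m]_x (v x * v x).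
  move=> t0; rewrite -mnn_integralZl//; last by rewrite lee_fin mulr_ge0.
  apply: (@le_trans _ _ (\int[m]_x ((t * t)%:E * (u x * u x) + v x * v x))).
    apply: mnn_integral_le.
    - by apply: mnnM => //; apply: mnn_cst; rewrite lee_fin mulr_ge0.
    - apply: mnnD; last exact: mnnM.
      by apply: mnnM; [apply: mnn_cst; rewrite lee_fin mulr_ge0|exact: mnnM].
    - move=> x; have := @mule2_le_sqr (t%:E * u x) (v x).
      rewrite mule_ge0 ?lee_fin// => /(_ isT (v0 x)).
      by rewrite !EFinM -!muleA (muleCA (u x)).
  rewrite mnn_integralD//; last 2 first.
    by apply: mnnM; [apply: mnn_cst; rewrite lee_fin mulr_ge0|exact: mnnM].
    exact: mnnM.
  rewrite leeD2r// mnn_integralZl; last 2 first.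
    exact: mnnM.
    by rewrite lee_fin mulr_ge0.
  by rewrite lee_pmul// ?lee_fin ?mulr_ge0//; apply: integral_ge0 => x _; exact: mule_ge0.
case: (\int[m]_x (v x * v x)) V0 key => [b||]//; last first.
  by move=> _ _; rewrite gt0_muley ?lte_fin// leey.
rewrite lee_fin => b0 key.
(* The case t = 1 already rules out an infinite I, so that the quotient I/K below is a real
   number. *)
have : I < +oo.
  rewrite ltNge; apply/negP; rewrite leye_eq => /eqP Ioo.
  by have := key 1%R ler01; rewrite Ioo gt0_muley ?lte_fin ?mulr1// -EFinM -EFinD.
move: I0 key; case: I => [i||]// i0 key _.
rewrite -!EFinM lee_fin.
have := key (i / K)%R; rewrite -!EFinM -EFinD !lee_fin in i0 *.
move=> /(_ (divr_ge0 i0 (ltW K0))).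
have -> : (2 * (i / K) * i = 2 * (i * i / K))%R by ring.
have -> : (i / K * (i / K) * K = i * i / K)%R by field; rewrite gt_eqF.
move=> h; rewrite (mulrC K) -ler_pdivrMr//; lra.
Qed.

End nonneg_measurable.

(** * Maps that preserve integrals *)

Section reflection.
Local Open Scope ereal_scope.
Context {R : realType}.

(** Invariance is phrased through integrals of nonnegative functions: in this form it composes, and
    Tonelli carries it to product measures. *)
Definition preserves (d : measure_display) (X : measurableType d)
    (m : {measure set X -> \bar R})
    (h : X -> X) :=
  measurable_fun setT h /\
  forall f : X -> \bar R, mnn f -> \int[m]_x f (h x) = \int[m]_x f x.

Lemma preserves_comp (d : measure_display) (X : measurableType d)
    (m : {measure set X -> \bar R})
    (h k : X -> X) : preserves m h -> preserves m k -> preserves m (h \o k).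
Proof.
move=> [mh ph] [mk pk]; split=> [|f mf /=]; first exact: measurableT_comp.
by rewrite (pk (fun x => f (h x)) (mnn_comp mh mf)) ph.
Qed.

Lemma preserves_prod (d d' : measure_display) (X : measurableType d)
    (Y : measurableType d')
    (m1 : {sigma_finite_measure set X -> \bar R})
    (m2 : {sigma_finite_measure set Y -> \bar R}) (h : X -> X) (k : Y -> Y) :
  preserves m1 h -> preserves m2 k ->
  preserves (m1 \x m2)%E (fun z : X * Y => (h z.1, k z.2)).
Proof.
move=> [mh ph] [mk pk].
have mhk : measurable_fun setT (fun z : X * Y => (h z.1, k z.2)).
  by apply: measurable_fun_pair; apply: measurableT_comp.
split=> // f mf.
rewrite !mnn_integral_prod//; last exact: mnn_comp mf.
have mI := mnn_integral m2 mf.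
rewrite -(ph _ mI); apply: eq_integral => x _ /=.
by rewrite (pk (fun y => f (h x, y)))//; exact: mnn_pair1.
Qed.

(** The preimage of an interval is an interval of the same length, and lengths of intervals
    determine Lebesgue measure. Reflections are enough: a translation is a composite of two of
    them. *)
Lemma preserves_lebesgue_reflect (c : R) :
  preserves (@lebesgue_measure R) (fun x : R => c - x)%R.
Proof.
have mh : measurable_fun setT (fun x : R => c - x)%R.
  by apply: measurable_funB => //; exact: measurable_cst.
split=> // f [mf f0].
have <- : \int[pushforward (@lebesgue_measure R) (fun x : R => (c - x)%R : measurableTypeR R)]_x f x
     = \int[@lebesgue_measure R]_x f x.
  apply: eq_measure_integral => A mA _; apply/esym.
  apply: (@lebesgue_measure_unique R (pushforward _ _)) => //= _ [[a b]] _ <-.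
  rewrite /pushforward /=.
  rewrite (_ : _ @^-1` _ = `[c - b, c - a[%classic)%R; last first.
    apply/seteqP; split=> x /=; rewrite !in_itv/=; lra.
  rewrite !lebesgue_measure_itv/= !lte_fin.
  have -> : (c - b < c - a)%R = (a < b)%R by apply/idP/idP; lra.
  by case: ifP => // _; rewrite -!EFinB; congr (_%:E); lra.
by rewrite ge0_integral_pushforward.
Qed.

End reflection.

(** * Closure properties of measurability *)

Section measurable_closure.
Context {R : realType} (d : measure_display) (X : measurableType d).

Lemma measurable_fun_fst (d1 d2 : measure_display) (Y1 : measurableType d1)
    (Y2 : measurableType d2) (f : X -> Y1 * Y2) :
  measurable_fun setT f -> measurable_fun setT (fun x => (f x).1).
Proof. exact: (measurableT_comp measurable_fst). Qed.

Lemma measurable_fun_snd (d1 d2 : measure_display) (Y1 : measurableType d1)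
    (Y2 : measurableType d2) (f : X -> Y1 * Y2) :
  measurable_fun setT f -> measurable_fun setT (fun x => (f x).2).
Proof. exact: (measurableT_comp measurable_snd). Qed.

Lemma measurable_fun_sub (f g : X -> R) : measurable_fun setT f ->
  measurable_fun setT g -> measurable_fun setT (fun x => f x - g x).
Proof. exact: measurable_funB. Qed.

Lemma measurable_fun_add (f g : X -> R) : measurable_fun setT f ->
  measurable_fun setT g -> measurable_fun setT (fun x => f x + g x).
Proof. exact: measurable_funD. Qed.

Lemma measurable_fun_mul (f g : X -> R) : measurable_fun setT f ->
  measurable_fun setT g -> measurable_fun setT (fun x => f x * g x).
Proof. exact: measurable_funM. Qed.

(** On [0,+oo[ the inverse is the power with exponent -1, even at the singularity: both conventions
    give the value 0 at 0. *)
Lemma measurable_fun_inv_ge0 (f : X -> R) : (forall x, 0 <= f x) ->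
  measurable_fun setT f -> measurable_fun setT (fun x => (f x)^-1).
Proof.
move=> f0 mf; under eq_fun => x do rewrite -powR_inv1//.
by apply: (measurableT_comp (f := fun t : R => powR t (-1))) mf; exact: measurable_powR.
Qed.

Lemma measurable_fun_sqrt (f : X -> R) :
  measurable_fun setT f -> measurable_fun setT (fun x => Num.sqrt (f x)).
Proof.
move=> mf; apply: (measurableT_comp (f := @Num.sqrt R)) => //.
by apply: continuous_measurable_fun; exact: sqrt_continuous.
Qed.

Lemma measurable_fun_if_real (b : X -> bool) (f : X -> R) :
  measurable_fun setT b -> measurable_fun setT f ->
  measurable_fun setT (fun x => if b x then f x else 0).
Proof. by move=> mb mf; exact: measurable_fun_ifT. Qed.

End measurable_closure.

(* Syntactic matching: plain [apply:] would unfold definitions at length. *)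
Ltac mfun_hook := fail.
Ltac mfun := repeat (cbv beta; first
  [ assumption
  | lazymatch goal with
    | |- measurable_fun _ (fun x => x) => apply: measurable_id
    | |- measurable_fun _ (@fst _ _) => apply: measurable_fst
    | |- measurable_fun _ (@snd _ _) => apply: measurable_snd
    | |- measurable_fun _ (fun _ => ?c) => apply: measurable_cst
    | |- measurable_fun _ (fun x => fst _) => apply: measurable_fun_fst
    | |- measurable_fun _ (fun x => snd _) => apply: measurable_fun_snd
    | |- measurable_fun _ (fun x => (_, _)) => apply: measurable_fun_pair
    | |- measurable_fun _ (fun x => _ - _) => apply: measurable_fun_sub
    | |- measurable_fun _ (fun x => _ + _) => apply: measurable_fun_add
    | |- measurable_fun _ (fun x => _ * _) => apply: measurable_fun_mul
    | |- measurable_fun _ (fun x => _ ^+ _) => apply: measurable_funX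
    | |- measurable_fun _ (fun x => Num.sqrt _) => apply: measurable_fun_sqrt
    | |- measurable_fun _ (fun x => _ && _) => apply: measurable_and
    | |- measurable_fun _ (fun x => _ < _) => apply: measurable_fun_ltr
    | |- measurable_fun _ (fun x => _ <= _) => apply: measurable_fun_ler
    end
  | mfun_hook
  | apply: measurable_fun_if_real ]).

(* The canonical sigma-finite structure of the library on a product measure
   is only found for products of subprobabilities. *)
Lemma sigma_finite_product {R : realType} (d d' : measure_display)
    (X : measurableType d) (Y : measurableType d')
    (m1 : {sigma_finite_measure set X -> \bar R})
    (m2 : {sigma_finite_measure set Y -> \bar R}) :
  sigma_finite setT (m1 \x m2)%E.
Proof.
by case: (lebesgue_integral_fubini.measure_function_Measure_isSigmaFinite__to__measure_function_isSigmaFinite m1 m2).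
Qed.

(** * Lebesgue measure and translations on R^2, R^3 and R^6 *)

Section space.
Context {R : realType}.
Notation R3 := (@R3 R).

Definition sub3 (x y : R3) : R3 := (x.1.1 - y.1.1, x.1.2 - y.1.2, x.2 - y.2).
Definition norm3 (z : R3) : R := Num.sqrt (z.1.1 ^+ 2 + z.1.2 ^+ 2 + z.2 ^+ 2).
Definition sub6 (x y : R3 * R3) : R3 * R3 := (sub3 x.1 y.1, sub3 x.2 y.2).

Lemma dist3E x y : dist3 x y = norm3 (sub3 x y). Proof. by []. Qed.

Lemma norm3_ge0 z : 0 <= norm3 z. Proof. exact: sqrtr_ge0. Qed.

HB.instance Definition _ := Measure.copy (@leb2 R)
  (@lebesgue_measure R \x @lebesgue_measure R)%E.
HB.instance Definition _ := Measure_isSigmaFinite.Build _ _ _ (@leb2 R)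
  (sigma_finite_product _ _).
HB.instance Definition _ := Measure.copy (@leb3 R)
  (@leb2 R \x @lebesgue_measure R)%E.
HB.instance Definition _ := Measure_isSigmaFinite.Build _ _ _ (@leb3 R)
  (sigma_finite_product (@leb2 R) _).
HB.instance Definition _ := Measure.copy (@leb6 R) (@leb3 R \x @leb3 R)%E.
HB.instance Definition _ := Measure_isSigmaFinite.Build _ _ _ (@leb6 R)
  (sigma_finite_product (@leb3 R) (@leb3 R)).

Lemma measurable_sub3 (d : measure_display) (X : measurableType d)
    (f g : X -> R3) : measurable_fun setT f -> measurable_fun setT g ->
  measurable_fun setT (fun x => sub3 (f x) (g x)).
Proof. by move=> mf mg; rewrite /sub3; mfun. Qed.

Lemma measurable_norm3 (d : measure_display) (X : measurableType d)
    (f : X -> R3) : measurable_fun setT f ->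
  measurable_fun setT (fun x => norm3 (f x)).
Proof. by move=> mf; rewrite /norm3; mfun. Qed.

Lemma measurable_inv_norm3 (d : measure_display) (X : measurableType d)
    (f : X -> R3) : measurable_fun setT f ->
  measurable_fun setT (fun x => (norm3 (f x))^-1).
Proof.
move=> mf; apply: measurable_fun_inv_ge0 => [x|]; first exact: norm3_ge0.
exact: measurable_norm3.
Qed.

Lemma measurable_sub6 (d : measure_display) (X : measurableType d)
    (f g : X -> R3 * R3) : measurable_fun setT f -> measurable_fun setT g ->
  measurable_fun setT (fun x => sub6 (f x) (g x)).
Proof.
by move=> mf mg; apply: measurable_fun_pair; apply: measurable_sub3; mfun.
Qed.

Lemma preserves_reflect3 c : preserves (@leb3 R) (sub3 c).
Proof.
have P : preserves (@leb2 R \x @lebesgue_measure R)%E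
    (fun z : R3 => ((c.1.1 - z.1.1, c.1.2 - z.1.2), c.2 - z.2)).
  apply: (@preserves_prod R _ _ _ _ (@leb2 R) (@lebesgue_measure R)
    (fun z : R * R => (c.1.1 - z.1, c.1.2 - z.2)) (fun t : R => c.2 - t)).
    have P : preserves (@lebesgue_measure R \x @lebesgue_measure R)%E
        (fun z : R * R => (c.1.1 - z.1, c.1.2 - z.2)).
      apply: (@preserves_prod R _ _ _ _ (@lebesgue_measure R) (@lebesgue_measure R)
        (fun t : R => c.1.1 - t) (fun t : R => c.1.2 - t));
      exact: preserves_lebesgue_reflect.
    exact: P.
  exact: preserves_lebesgue_reflect.
exact: P.
Qed.

Lemma preserves_translate6 c : preserves (@leb6 R) (sub6 ^~ c).
Proof.
have -> : sub6 ^~ c = (sub6 ((0, 0, 0), (0, 0, 0))) \o (sub6 c).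
  by apply/funext => x; rewrite /sub6 /sub3 /= !sub0r !opprB.
have P b : preserves (@leb3 R \x @leb3 R)%E (sub6 b).
  exact: (@preserves_prod R _ _ _ _ (@leb3 R) (@leb3 R) (sub3 b.1) (sub3 b.2)
    (preserves_reflect3 _) (preserves_reflect3 _)).
exact: preserves_comp (P _) (P _).
Qed.

Lemma preserves_translate2 (c : R * R) :
  preserves (@leb2 R) (fun e : R * R => (e.1 - c.1, e.2 - c.2)).
Proof.
have -> : (fun e : R * R => (e.1 - c.1, e.2 - c.2)) =
    (fun e => (0 - e.1, 0 - e.2)) \o (fun e => (c.1 - e.1, c.2 - e.2)).
  by apply/funext => e /=; rewrite !sub0r !opprB.
have P (b : R * R) : preserves (@lebesgue_measure R \x @lebesgue_measure R)%E
    (fun e : R * R => (b.1 - e.1, b.2 - e.2)).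
  exact: (@preserves_prod R _ _ _ _ (@lebesgue_measure R) (@lebesgue_measure R)
    (fun t : R => b.1 - t) (fun t : R => b.2 - t)
    (preserves_lebesgue_reflect _) (preserves_lebesgue_reflect _)).
exact: preserves_comp (P (0, 0)) (P c).
Qed.

End space.

Ltac mfun_hook ::= lazymatch goal with
  | |- measurable_fun _ (fun x => sub3 _ _) => apply: measurable_sub3
  | |- measurable_fun _ (fun x => sub6 _ _) => apply: measurable_sub6
  | |- measurable_fun _ (fun x => (norm3 _)^-1) => apply: measurable_inv_norm3
  | |- measurable_fun _ (fun x => norm3 _) => apply: measurable_norm3
  end.

(** * Integrability of 1/|z|^2 on a ball of R^3 *)

Section inverse_square.
Context {R : realType}.
Notation R3 := (@R3 R).
Variable T : R.
Hypothesis T_gt0 : 0 < T.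

(** The summand T^-2 matters only at z = 0, where [(norm3 z)^-1] is 0 by convention: with it the
    kernel is at least T^-2 on the whole ball, so later inequalities hold pointwise without
    exceptions. *)
Definition ball_ker (z : R3) : R :=
  if norm3 z <= T then (norm3 z)^-1 ^+ 2 + T^-1 ^+ 2 else 0.

Lemma ball_ker_ge0 z : 0 <= ball_ker z.
Proof. by rewrite /ball_ker; case: ifP => // _; rewrite addr_ge0// sqr_ge0. Qed.

Lemma mnn_ball_ker (d : measure_display) (X : measurableType d) (f : X -> R3) :
  measurable_fun setT f -> mnn (fun x => (ball_ker (f x))%:E).
Proof.
move=> mf; apply: mnn_EFin => [|x]; last exact: ball_ker_ge0.
by rewrite /ball_ker; mfun.
Qed.

Lemma coord_le_norm3 (z : R3) :
  [/\ `|z.1.1| <= norm3 z, `|z.1.2| <= norm3 z & `|z.2| <= norm3 z].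
Proof.
rewrite /norm3; split; rewrite -sqrtr_sqr ler_wsqrtr//;
  have := sqr_ge0 z.1.1; have := sqr_ge0 z.1.2; have := sqr_ge0 z.2; lra.
Qed.

Lemma dyadic_scale (r : R) : 0 < r -> r <= T ->
  exists n, T / 2 ^+ n.+1 < r /\ r <= T / 2 ^+ n.
Proof.
move=> r0 rT.
have p2 n : (0 < 2 ^+ n :> R) by rewrite exprn_gt0.
have ex : exists n, T / 2 ^+ n.+1 < r.
  exists (Num.bound (T / r)).
  rewrite ltr_pdivrMr// -ltr_pdivrMl// mulrC.
  by apply: (upper_nthrootP (i := _.+1)).
case: (ex_minnP ex) => -[|n] nr nmin; [exists 0|exists n.+1]; split=> //.
  by rewrite expr0 divr1.
by rewrite leNgt; apply/negP => /nmin; rewrite ltnn.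
Qed.

(** Cubes stand in for dyadic shells: their volume is a product of lengths, and their overlap is
    harmless because the series only has to dominate the kernel. *)
Let cube n : set R3 := let I := `[- (T / 2 ^+ n), T / 2 ^+ n]%classic in
  (I `*` I) `*` I.

(** On the shell T/2^(n+1) < |z| <= T/2^n one has 1/|z|^2 < 4^(n+1)/T^2; the factor 2 absorbs the
    extra T^-2. *)
Let cst_cube n : R := 2 * 4 ^+ n.+1 * T^-1 ^+ 2.

Let ball_ker_le_cubes z :
  ((ball_ker z)%:E <= \sum_(0 <= n <oo) (cst_cube n * \1_(cube n) z)%:E)%E.
Proof.
have c0 n : 0 <= cst_cube n.
  by rewrite /cst_cube mulr_ge0 ?sqr_ge0// mulr_ge0// exprn_ge0.
have t0 n : (0 <= (cst_cube n * \1_(cube n) z)%:E)%E.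
  by rewrite lee_fin mulr_ge0.
rewrite /ball_ker; case: ifPn => [zT|_]; last by apply: nneseries_ge0.
suff [n [zn hn]] : exists n, cube n z /\
    (norm3 z)^-1 ^+ 2 + T^-1 ^+ 2 <= cst_cube n.
  apply: (@le_trans _ _ (cst_cube n * \1_(cube n) z)%:E).
    by rewrite indicE mem_set// mulr1 lee_fin.
  apply: le_trans (nneseries_lim_ge n.+1 _) => //.
  by rewrite big_nat_recr//= leeDr//; apply: sume_ge0.
have Ti : 0 <= T^-1 ^+ 2 by exact: sqr_ge0.
(* The origin lies in no shell, but there the kernel is just T^-2 and the largest cube suffices. *)
have [z0|zn0] := eqVneq (norm3 z) 0.
  exists 0; have [] := coord_le_norm3 z; rewrite z0 !normr_le0 => /eqP a /eqP b /eqP c.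
  split.
    by rewrite /cube /= a b c expr0 divr1 !in_itv/= !oppr_le0 !(ltW T_gt0).
  rewrite invr0 expr0n/= add0r /cst_cube expr1; lra.
have zp : 0 < norm3 z by rewrite lt_neqAle eq_sym zn0 norm3_ge0.
have [n [n1 n2]] := dyadic_scale zp zT.
exists n; split.
  have [a b c] := coord_le_norm3 z.
  rewrite /cube /= !in_itv/= -!ler_norml.
  by split; [split|]; exact: le_trans n2.
have p2 m : (0 < 2 ^+ m :> R) by rewrite exprn_gt0.
rewrite /cst_cube (_ : 4 = 2 ^+ 2)// -?exprM; last by rewrite expr2; lra.
have : (norm3 z)^-1 <= 2 ^+ n.+1 * T^-1.
  rewrite -[leRHS]invrK lef_pV2 ?posrE// ?invr_gt0 ?mulr_gt0 ?invr_gt0//.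
  by rewrite invfM invrK mulrC ltW.
have i0 : 0 <= (norm3 z)^-1 by rewrite invr_ge0 ltW.
move=> /(lerXn2r 2); rewrite !nnegrE i0 mulr_ge0 ?invr_ge0 ?(ltW T_gt0) ?(ltW (p2 _))//.
move=> /(_ isT isT); rewrite exprMn -exprM mulnC => h1.
have h2 : 1 <= 2 ^+ (2 * n.+1) :> R by rewrite exprn_ege1// ler1n.
have := ler_wpM2r Ti h2; lra.
Qed.

Lemma integral_ball_ker_fin : (\int[leb3]_z (ball_ker z)%:E < +oo)%E.
Proof.
have c0 n : 0 <= cst_cube n.
  by rewrite /cst_cube mulr_ge0 ?sqr_ge0// mulr_ge0// exprn_ge0.
have mc n : measurable (cube n).
  by apply: measurableX; [apply: measurableX|].
have mt n : mnn (fun z => (cst_cube n * \1_(cube n) z)%:E).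
  apply: mnn_EFin => [|z]; last by rewrite mulr_ge0.
  by apply: measurable_fun_mul => //; exact: measurable_indic.
apply: (@le_lt_trans _ _
  (\int[leb3]_z \sum_(0 <= n <oo) (cst_cube n * \1_(cube n) z)%:E)%E).
  apply: mnn_integral_le => [||z].
  - exact: mnn_ball_ker.
  - split=> [|z]; last by apply: nneseries_ge0 => n _ _; exact: (mt n).2.
    by apply: ge0_emeasurable_sum => n *; [exact: (mt n).2|exact: (mt n).1].
  - exact: ball_ker_le_cubes.
rewrite integral_nneseries//; last 2 first.
  by move=> n; exact: (mt n).1.
  by move=> n z _; exact: (mt n).2.
(* Constant times volume is (2 4^(n+1) / T^2) (2T/2^n)^3 = 64 T/2^n, that is 128 T/2^(n+1): the
   shape of series that [epsilon_trick0] sums. *)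
apply: (@le_lt_trans _ _ (\sum_(0 <= n <oo) ((128 * T) / (2 ^ n.+1)%:R)%:E)%E); last first.
  apply: le_lt_trans (epsilon_trick0 xpredT _) _; last exact: ltry.
  by rewrite mulr_ge0// ltW.
apply: lee_nneseries => [n _ _|n _].
  by apply: integral_ge0 => z _; exact: (mt n).2.
under eq_integral => z _ do rewrite EFinM.
rewrite mnn_integralZl ?lee_fin//; last first.
  by apply: mnn_EFin => //; apply: measurable_indic; exact: mc.
rewrite integral_indic//; last exact: mc.
rewrite setIT.
have p2 m : (0 < 2 ^+ m :> R) by rewrite exprn_gt0.
have E : leb3 (cube n) = ((2 * (T / 2 ^+ n)) ^+ 3)%:E.
  pose I : set R := `[- (T / 2 ^+ n), T / 2 ^+ n]%classic.
  have mI : measurable I by exact: measurable_itv.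
  have lI : lebesgue_measure I = (2 * (T / 2 ^+ n))%:E.
    rewrite lebesgue_measure_itv/= lte_fin.
    rewrite ifT; last by have := divr_gt0 T_gt0 (p2 n); lra.
    by rewrite -EFinB; congr (_%:E); ring.
  transitivity (leb2 (I `*` I) * lebesgue_measure I)%E.
    by apply: (product_measure1E (@leb2 R) (@lebesgue_measure R)); [apply: measurableX|].
  rewrite lI (_ : leb2 (I `*` I) = lebesgue_measure I * lebesgue_measure I)%E.
    by rewrite lI -!EFinM; congr (_%:E); ring.
  by apply: (product_measure1E (@lebesgue_measure R) (@lebesgue_measure R)); exact: mI.
apply: (@le_trans _ _ ((cst_cube n)%:E * leb3 (cube n))%E); first exact: lexx.
rewrite E -EFinM lee_fin /cst_cube natrX (_ : 4 = 2 ^+ 2); last by rewrite expr2; lra.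
rewrite le_eqVlt; apply/orP; left; apply/eqP.
rewrite exprAC !exprS !expr0.
have := lt0r_neq0 (p2 n); move: (2 ^+ n) => q q0; field.
by rewrite q0 gt_eqF.
Qed.

End inverse_square.

(** * Retarded times and the square of admissible times *)

Section retardation.
Context {R : realType}.
Notation R3 := (@R3 R).

(** Time 0 is left out because [a] vanishes there and the weight could not be divided out; the
    discarded edges are null. Applied to retarded times, the strict bounds also do the work of the
    Heaviside factors. *)
Definition in_square (T : R) (e : R * R) : bool :=
  ((0 < e.1) && (e.1 <= T)) && ((0 < e.2) && (e.2 <= T)).

Definition retard (e : R * R) (z : R3 * R3) : R * R :=
  (e.1 - norm3 z.1, e.2 - norm3 z.2).

Lemma measurable_retard (d : measure_display) (X : measurableType d)
    (f : X -> R * R) (g : X -> R3 * R3) :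
  measurable_fun setT f -> measurable_fun setT g ->
  measurable_fun setT (fun x => retard (f x) (g x)).
Proof. by move=> mf mg; rewrite /retard; mfun. Qed.

Lemma measurable_in_square (T : R) (d : measure_display)
    (X : measurableType d) (f : X -> R * R) : measurable_fun setT f ->
  measurable_fun setT (fun x => in_square T (f x)).
Proof. by move=> mf; rewrite /in_square; mfun. Qed.

End retardation.

Ltac mfun_hook ::= lazymatch goal with
  | |- measurable_fun _ (fun x => sub3 _ _) => apply: measurable_sub3
  | |- measurable_fun _ (fun x => sub6 _ _) => apply: measurable_sub6
  | |- measurable_fun _ (fun x => (norm3 _)^-1) => apply: measurable_inv_norm3
  | |- measurable_fun _ (fun x => norm3 _) => apply: measurable_norm3
  | |- measurable_fun _ (fun x => in_square _ _) => apply: measurable_in_square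
  | |- measurable_fun _ (fun x => retard _ _) => apply: measurable_retard
  end.

(** * The scalar majorant operator and its L^2 estimate *)

Section majorant.
Context {R : realType}.
Notation R3 := (@R3 R).
Variables T B : R.
Hypotheses (T_gt0 : 0 < T) (B_ge0 : 0 <= B).

(** The constant [B] will take up the coupling, the bound of [f] and the values of [a] at the
    retarded times. *)
Definition maj_ker (e : R * R) (x y : R3 * R3) : R :=
  if in_square T e && in_square T (retard e (sub6 x y)) then
    B * ((norm3 (sub3 x.1 y.1))^-1 * (norm3 (sub3 x.2 y.2))^-1
         * (norm3 (sub3 y.1 y.2))^-1)
  else 0.

Definition maj_op (G : (R * R) * (R3 * R3) -> \bar R)
    (p : (R * R) * (R3 * R3)) : \bar R :=
  (\int[leb6]_y ((maj_ker p.1 p.2 y)%:E * G (retard p.1 (sub6 p.2 y), y)))%E.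

Definition sqnorm (G : (R * R) * (R3 * R3) -> \bar R) (e : R * R) : \bar R :=
  (\int[leb6]_x (G (e, x) * G (e, x)))%E.

Lemma measurable_maj_ker (d : measure_display) (X : measurableType d)
    (f : X -> R * R) (g h : X -> R3 * R3) :
  measurable_fun setT f -> measurable_fun setT g -> measurable_fun setT h ->
  measurable_fun setT (fun x => maj_ker (f x) (g x) (h x)).
Proof.
by move=> mf mg mh; rewrite /maj_ker; mfun.
Qed.

Lemma maj_ker_ge0 e x y : 0 <= maj_ker e x y.
Proof.
by rewrite /maj_ker; case: ifP => // _; rewrite !mulr_ge0 ?invr_ge0 ?norm3_ge0.
Qed.

Lemma mnn_maj_integrand G : mnn G ->
  mnn (fun q : ((R * R) * (R3 * R3)) * (R3 * R3) =>
    (maj_ker q.1.1 q.1.2 q.2)%:E * G (retard q.1.1 (sub6 q.1.2 q.2), q.2))%E.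
Proof.
move=> mG; apply: mnnM.
  by apply: mnn_EFin => [|q]; [apply: measurable_maj_ker; mfun|exact: maj_ker_ge0].
by apply: mnn_comp mG; mfun.
Qed.

Lemma mnn_maj_op G : mnn G -> mnn (maj_op G).
Proof. by move=> /mnn_maj_integrand /(mnn_integral (@leb6 R)). Qed.

Lemma mnn_sqnorm G : mnn G -> mnn (sqnorm G).
Proof. by move=> mG; exact: (mnn_integral (@leb6 R) (mnnM mG mG)). Qed.

Lemma integral_leb6 (f : R3 * R3 -> \bar R) : mnn f ->
  (\int[leb6]_z f z = \int[leb3]_x \int[leb3]_y f (x, y))%E.
Proof. exact: (mnn_integral_prod (@leb3 R) (@leb3 R)). Qed.

Let J : R := fine (\int[leb3]_z (ball_ker T z)%:E)%E.

Let J_ge0 : 0 <= J.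
Proof. by apply: fine_ge0; apply: integral_ge0 => z _; rewrite lee_fin ball_ker_ge0. Qed.

Let JE : (\int[leb3]_z (ball_ker T z)%:E)%E = J%:E.
Proof.
rewrite /J fineK// ge0_fin_numE; first exact: integral_ball_ker_fin.
by apply: integral_ge0 => z _; rewrite lee_fin ball_ker_ge0.
Qed.

Let J_reflect c : (\int[leb3]_z (ball_ker T (sub3 c z))%:E)%E = J%:E.
Proof.
rewrite -JE; have [_ P] := preserves_reflect3 c.
by apply: (P (fun z => (ball_ker T z)%:E)); apply: mnn_ball_ker; mfun.
Qed.

(** When the times and the retarded times lie in ]0,T], each |x_i - y_i| is less than T. This weaker
    condition does not mention the times, so the constants drawn from it are uniform in them. *)
Let cutoff (x y : R3 * R3) : bool :=
  (norm3 (sub3 x.1 y.1) <= T) && (norm3 (sub3 x.2 y.2) <= T).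

Let cut_coulomb (x y : R3 * R3) : R :=
  if cutoff x y then (norm3 (sub3 y.1 y.2))^-1 else 0.

Let mnn_cut_coulomb x : mnn (fun y => (cut_coulomb x y)%:E).
Proof.
apply: mnn_EFin => [|y]; rewrite /cut_coulomb /cutoff; first by mfun.
by case: ifP => // _; rewrite invr_ge0 norm3_ge0.
Qed.

Let ball_ker_ge_inv z : norm3 z <= T -> T^-1 ^+ 2 <= ball_ker T z.
Proof. by move=> zT; rewrite /ball_ker zT lerDr sqr_ge0. Qed.

(** The factor T^2 [ball_ker] in x1-y1 is at least 1 on the cutoff and only confines y1. The
    singularity 1/|y1-y2|^2 is bounded by [ball_ker] at y1-y2 if |y1-y2| <= T; otherwise it is below
    T^-2, hence below [ball_ker] at x2-y2. Integrating y2 first then gives a bound independent of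
    y1. *)
Let cut_coulomb_sqr_le x y : cut_coulomb x y * cut_coulomb x y <=
  T ^+ 2 * ball_ker T (sub3 x.1 y.1)
    * (ball_ker T (sub3 y.1 y.2) + ball_ker T (sub3 x.2 y.2)).
Proof.
rewrite /cut_coulomb /cutoff; case: ifPn => [/andP[x1 x2]|_]; last first.
  by rewrite mul0r !mulr_ge0 ?addr_ge0 ?ball_ker_ge0 ?(ltW T_gt0).
have h1 : 1 <= T ^+ 2 * ball_ker T (sub3 x.1 y.1).
  rewrite -(ler_pM2l (x := T^-1 ^+ 2)); last by rewrite exprn_gt0 ?invr_gt0.
  rewrite mulrA -exprMn mulVf ?gt_eqF// expr1n mul1r mulr1.
  exact: ball_ker_ge_inv.
rewrite -[leLHS]mul1r; apply: ler_pM => //.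
  by rewrite -expr2 sqr_ge0.
rewrite -expr2; have [yT|yT] := leP (norm3 (sub3 y.1 y.2)) T.
  rewrite -[leLHS]addr0 lerD ?ball_ker_ge0// /ball_ker yT lerDl sqr_ge0//.
rewrite -[leLHS]add0r lerD ?ball_ker_ge0//.
apply: le_trans (ball_ker_ge_inv x2).
rewrite lerXn2r ?nnegrE ?invr_ge0 ?norm3_ge0 ?(ltW T_gt0)//.
by rewrite lef_pV2 ?posrE ?(ltW yT)// (lt_trans T_gt0 yT).
Qed.

(** The product is the integral of the preceding bound; the added 1 supplies the strict positivity
    that [integral_cauchy_schwarz] asks for. *)
Let K : R := T ^+ 2 * J * (J + J) + 1.

Let K_gt0 : 0 < K.
Proof. by rewrite /K ltr_wpDl// !mulr_ge0 ?addr_ge0// ?sqr_ge0 ?(ltW T_gt0). Qed.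

Let cut_coulomb_L2 x :
  (\int[leb6]_y ((cut_coulomb x y)%:E * (cut_coulomb x y)%:E) <= K%:E)%E.
Proof.
pose F (y : R3 * R3) := ((T ^+ 2 * ball_ker T (sub3 x.1 y.1))%:E
    * ((ball_ker T (sub3 y.1 y.2))%:E + (ball_ker T (sub3 x.2 y.2))%:E))%E.
have mb (f : R3 * R3 -> R3) : measurable_fun setT f ->
  mnn (fun y => (ball_ker T (f y))%:E) by exact: mnn_ball_ker.
have T20 : 0 <= T ^+ 2 by exact: sqr_ge0.
have mF : mnn F.
  apply: mnnM; last by apply: mnnD; apply: mb; mfun.
  under eq_fun => y do rewrite EFinM.
  by apply: mnnM; [exact: mnn_cst|apply: mb; mfun].
apply: (@le_trans _ _ (\int[leb6]_y F y)%E).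
  apply: mnn_integral_le => // [|y]; first exact: mnnM (mnn_cut_coulomb x) (mnn_cut_coulomb x).
  by rewrite /F -EFinM -EFinD -EFinM lee_fin cut_coulomb_sqr_le.
rewrite integral_leb6// /F /=.
have mr c : mnn (fun z => (ball_ker T (sub3 c z))%:E).
  exact: (mnn_ball_ker T (proj1 (preserves_reflect3 c))).
under eq_integral => y1 _.
  rewrite mnn_integralZl; last 2 first.
  - by apply: mnnD; exact: mr.
  - by rewrite lee_fin mulr_ge0// ball_ker_ge0.
  rewrite mnn_integralD; [|exact: mr|exact: mr].
  rewrite !J_reflect -EFinD muleC EFinM muleA.
  over.
rewrite /= mnn_integralZl; [|exact: mr|by rewrite -EFinM lee_fin mulr_ge0// addr_ge0].
rewrite J_reflect -!EFinM lee_fin /K; lra.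
Qed.

Let C : R := B ^+ 2 * K.

(* Cauchy-Schwarz splits the kernel as (1/|y1-y2|) (G/(r1 r2)); the first factor
   has bounded L2-norm over the light cone, and translating x turns the second
   one into a convolution in the retarded times. *)
Lemma sqnorm_maj_op : exists2 c : R, 0 <= c & forall G e, mnn G ->
  (sqnorm (maj_op G) e <= c%:E * \int[leb6]_z
     ((ball_ker T z.1 * ball_ker T z.2)%:E * sqnorm G (retard e z)))%E.
Proof.
have C0 : 0 <= C by rewrite mulr_ge0 ?sqr_ge0 ?(ltW K_gt0).
exists C => // G e mG.
have rhs0 : (0 <= C%:E * \int[leb6]_z
     ((ball_ker T z.1 * ball_ker T z.2)%:E * sqnorm G (retard e z)))%E.
  rewrite mule_ge0// ?lee_fin//; apply: integral_ge0 => z _.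
  by rewrite mule_ge0 ?lee_fin ?mulr_ge0 ?ball_ker_ge0//; exact: (mnn_sqnorm mG).2.
have [eQ|eQ] := boolP (in_square T e); last first.
  rewrite (_ : sqnorm _ _ = 0%E)//; apply: integral0_eq => x _.
  rewrite (_ : maj_op _ _ = 0%E) ?mul0e//; apply: integral0_eq => y _ /=.
  by rewrite /maj_ker (negbTE eQ) mul0e.
pose v (q : (R3 * R3) * (R3 * R3)) : \bar R :=
  ((if cutoff q.1 q.2 then (norm3 (sub3 q.1.1 q.2.1))^-1
      * (norm3 (sub3 q.1.2 q.2.2))^-1 else 0)%:E
    * G (retard e (sub6 q.1 q.2), q.2))%E.
have mGq : mnn (fun q : (R3 * R3) * (R3 * R3) => G (retard e (sub6 q.1 q.2), q.2)).
  by apply: mnn_comp mG; mfun.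
have mv : mnn v.
  apply: mnnM => //; apply: mnn_EFin => [|q].
    by rewrite /cutoff; mfun.
  by case: ifP => // _; rewrite mulr_ge0 ?invr_ge0 ?norm3_ge0.
(* [H] at (x-y, y) dominates the square of [v]: on the cutoff each 1/|x_i-y_i|^2 is at most
   [ball_ker]. Its first argument is the displacement, which becomes a free variable once x is
   translated by y. *)
pose H (q : (R3 * R3) * (R3 * R3)) : \bar R :=
  ((ball_ker T q.1.1 * ball_ker T q.1.2)%:E
    * (G (retard e q.1, q.2) * G (retard e q.1, q.2)))%E.
have mH : mnn H.
  apply: mnnM; last first.
    have : mnn (fun q : (R3 * R3) * (R3 * R3) => G (retard e q.1, q.2)).
      by apply: mnn_comp mG; mfun.
    by move=> m; exact: mnnM.
  under eq_fun => q do rewrite EFinM.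
  by apply: mnnM; apply: mnn_ball_ker; mfun.
have mHs : mnn (fun q : (R3 * R3) * (R3 * R3) => H (sub6 q.1 q.2, q.2)).
  by apply: mnn_comp mH; mfun.
have step x : (maj_op G (e, x) * maj_op G (e, x) <=
    C%:E * \int[leb6]_y H (sub6 x y, y))%E.
  have mu := mnn_cut_coulomb x.
  have mvx : mnn (fun y => v (x, y)) by exact: mnn_pair1.
  have cs := integral_cauchy_schwarz (m := @leb6 R) mu mvx K_gt0 (cut_coulomb_L2 x).
  have le1 : (maj_op G (e, x) <=
      B%:E * \int[leb6]_y ((cut_coulomb x y)%:E * v (x, y)))%E.
    rewrite -mnn_integralZl; [|exact: mnnM|by rewrite lee_fin].
    apply: mnn_integral_le => [||y].
    - exact: (mnn_pair1 (e, x) (mnn_maj_integrand mG)).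
    - by apply: mnnM; [exact: mnn_cst|exact: mnnM].
    - rewrite /maj_ker /cut_coulomb /v /= eQ /=; have G0 := mG.2.
      case: ifPn => [/andP[/andP[s1 _] /andP[s2 _]]|_]; last first.
        rewrite mul0e; case: ifP => _; last by rewrite mul0e mule0.
        by rewrite !mule_ge0// lee_fin ?mulr_ge0 ?invr_ge0 ?norm3_ge0.
      have -> : cutoff x y.
        have /andP[/andP[_ e1] /andP[_ e2]] := eQ.
        move: s1 s2; rewrite /cutoff /retard /= !subr_gt0 => s1 s2.
        by rewrite (le_trans (ltW s1) e1) (le_trans (ltW s2) e2).
      rewrite muleA -!EFinM [X in (X%:E * _)%E](_ : _ = B * ((norm3 (sub3 y.1 y.2))^-1 *
        ((norm3 (sub3 x.1 y.1))^-1 * (norm3 (sub3 x.2 y.2))^-1))); last by ring.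
      by rewrite !EFinM -!muleA.
  have I0 : (0 <= \int[leb6]_y ((cut_coulomb x y)%:E * v (x, y)))%E.
    by apply: integral_ge0 => y _; rewrite mule_ge0; [|exact: mu.2|exact: mvx.2].
  have P0 : (0 <= maj_op G (e, x))%E by exact: (mnn_maj_op mG).2.
  apply: (le_trans (lee_pmul P0 P0 le1 le1)).
  have -> : C%:E = ((B ^+ 2)%:E * K%:E)%E by rewrite -EFinM.
  rewrite muleACA -EFinM -expr2 -muleA lee_pmul//.
  - by rewrite lee_fin sqr_ge0.
  - exact: mule_ge0.
  - apply: (le_trans cs); rewrite lee_pmul ?lee_fin ?(ltW K_gt0)//.
      by apply: integral_ge0 => y _; apply: mule_ge0; exact: mvx.2.
    apply: mnn_integral_le => [||y]; [exact: mnnM|exact: mnn_pair1 mHs|].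
    rewrite /v /H /= muleACA -EFinM lee_pmul//.
    + by rewrite lee_fin -expr2 sqr_ge0.
    + by apply: mule_ge0; exact: mG.2.
    + rewrite lee_fin /cutoff; case: ifPn => [/andP[c1 c2]|_]; last first.
        by rewrite mul0r mulr_ge0 ?ball_ker_ge0.
      rewrite mulrACA -!expr2 ler_pM ?sqr_ge0// /ball_ker ?c1 ?c2 lerDl sqr_ge0//.
apply: (@le_trans _ _ (\int[leb6]_x (C%:E * \int[leb6]_y H (sub6 x y, y)))%E).
  apply: mnn_integral_le => [||x]; last exact: step.
  - have := mnn_pair1 e (mnn_maj_op mG) => m; exact: mnnM.
  - apply: mnnM; first exact: mnn_cst.
    exact: (mnn_integral (@leb6 R) mHs).
rewrite mnn_integralZl ?lee_fin//; last exact: (mnn_integral (@leb6 R) mHs).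
rewrite le_eqVlt; apply/orP; left; apply/eqP; congr (_ * _)%E.
rewrite (mnn_tonelli (@leb6 R) (@leb6 R) mHs) /=.
transitivity (\int[leb6]_y \int[leb6]_z H (z, y))%E.
  apply: eq_integral => y _.
  have [_ tr] := preserves_translate6 y.
  by rewrite (tr (fun z => H (z, y)))//; exact: mnn_pair2.
rewrite -(mnn_tonelli (@leb6 R) (@leb6 R) mH).
apply: eq_integral => z _; rewrite /sqnorm -mnn_integralZl//.
- by have := mnn_pair1 (retard e z) mG => m; exact: mnnM.
- by rewrite lee_fin mulr_ge0 ?ball_ker_ge0.
Qed.

End majorant.

(** * Monotone limits and Picard iteration with nonnegative kernels *)

Section monotone_limits.
Local Open Scope ereal_scope.
Context {R : realType}.

Lemma mnn_cvg (d : measure_display) (X : measurableType d)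
    (m : {measure set X -> \bar R}) (f : nat -> X -> \bar R) (g : X -> \bar R) :
  (forall n, mnn (f n)) -> (forall x, nondecreasing_seq (f ^~ x)) ->
  (forall x, f n x @[n --> \oo] --> g x) ->
  mnn g /\ \int[m]_x f n x @[n --> \oo] --> \int[m]_x g x.
Proof.
move=> mf ndf fg; split.
  split=> [|x].
    apply: (emeasurable_fun_cvg f) => [n|x _]; [exact: (mf n).1|exact: fg].
  by apply: cvge_ge (fg x); apply: nearW => n; exact: (mf n).2.
rewrite (_ : \int[m]_x g x = \int[m]_x limn (f ^~ x)).
  apply: cvg_monotone_convergence => //.
  - by move=> n; exact: (mf n).1.
  - by move=> n x _; exact: (mf n).2.
by apply: eq_integral => x _; apply/esym/cvg_lim => //; exact: fg.
Qed.

End monotone_limits.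

Section positive_fixpoint.
Local Open Scope ereal_scope.
Context {R : realType} (d d' : measure_display) (X : measurableType d)
  (Y : measurableType d') (m : {sigma_finite_measure set Y -> \bar R})
  (I : finType) (k : I -> I -> X * Y -> R) (s : X * Y -> X).
Hypothesis mk : forall i j, measurable_fun setT (k i j).
Hypothesis k0 : forall i j q, (0 <= k i j q)%R.
Hypothesis ms : measurable_fun setT s.

Definition kernel_op (V : I -> X -> \bar R) (i : I) (p : X) : \bar R :=
  \int[m]_y \sum_(j : I) ((k i j (p, y))%:E * V j (s (p, y))).

Lemma mnn_kernel_integrand V i : (forall j, mnn (V j)) ->
  mnn (fun q : X * Y => \sum_(j : I) ((k i j q)%:E * V j (s q))).
Proof.
move=> mV; apply: mnn_sum => j; apply: mnnM; first exact: mnn_EFin.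
exact: mnn_comp (mV j).
Qed.

Lemma mnn_kernel_op V i : (forall j, mnn (V j)) -> mnn (kernel_op V i).
Proof. by move=> mV; exact: (mnn_integral m (mnn_kernel_integrand i mV)). Qed.

Lemma kernel_op_le V W i p : (forall j, mnn (V j)) -> (forall j, mnn (W j)) ->
  (forall j q, V j q <= W j q) -> kernel_op V i p <= kernel_op W i p.
Proof.
move=> mV mW VW; apply: mnn_integral_le => [||y].
- exact: mnn_pair1 (mnn_kernel_integrand i mV).
- exact: mnn_pair1 (mnn_kernel_integrand i mW).
- by apply: lee_sum => j _; rewrite lee_pmul ?lee_fin//; exact: (mV j).2.
Qed.

Lemma kernel_op_cvg (V : nat -> I -> X -> \bar R) W i p :
  (forall n j, mnn (V n j)) -> (forall j q, nondecreasing_seq (fun n => V n j q)) ->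
  (forall j q, V n j q @[n --> \oo] --> W j q) ->
  kernel_op (V n) i p @[n --> \oo] --> kernel_op W i p.
Proof.
move=> mV ndV VW.
have mVi n : mnn (fun y => \sum_(j : I) ((k i j (p, y))%:E * V n j (s (p, y)))).
  exact: (mnn_pair1 p (mnn_kernel_integrand i (mV n))).
apply: (mnn_cvg m mVi _ _).2 => y.
  move=> n1 n2 n12; apply: lee_sum => j _.
  by rewrite lee_pmul ?lee_fin//; [exact: (mV n1 j).2|exact: ndV].
apply: cvg_nnesum => j _; last by apply: cvgeZl => //; exact: VW.
by apply: nearW => n; rewrite mule_ge0 ?lee_fin//; exact: (mV n j).2.
Qed.

Variable U0 : I -> X -> \bar R.
Hypothesis mU0 : forall i, mnn (U0 i).

Fixpoint picard n : I -> X -> \bar R :=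
  if n is n'.+1 then fun i p => U0 i p + kernel_op (picard n') i p else U0.

(** The limit exists everywhere in [0,+oo] by monotonicity alone; finiteness is a separate matter,
    settled later by norm bounds. *)
Definition fixpoint i p : \bar R := limn (fun n => picard n i p).

Lemma mnn_picard n i : mnn (picard n i).
Proof. by elim: n i => [//|n IH] i; apply: mnnD => //; exact: mnn_kernel_op. Qed.

Lemma nondecreasing_picard i p : nondecreasing_seq (fun n => picard n i p).
Proof.
apply/nondecreasing_seqP => n; elim: n i p => [|n IH] i p /=.
  by rewrite leeDl//; exact: (mnn_kernel_op i mU0).2.
by rewrite leeD2l//; apply: kernel_op_le => //; [|exact: (@mnn_picard n.+1)]; exact: mnn_picard.
Qed.

Lemma picard_cvg i p : picard n i p @[n --> \oo] --> fixpoint i p.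
Proof. by apply: ereal_nondecreasing_is_cvgn; exact: nondecreasing_picard. Qed.

Lemma mnn_fixpoint i : mnn (fixpoint i).
Proof.
(* Only the measurability of the limit is wanted and [X] carries no measure here, so the zero
   measure fills the slot. *)
have [] := @mnn_cvg R d X mzero (fun n => picard n i) (fixpoint i).
- by move=> n; exact: mnn_picard.
- exact: nondecreasing_picard.
- exact: picard_cvg.
- by [].
Qed.

(** Monotone convergence takes the limit through [kernel_op], so both sides are the limit of the
    shifted sequence [picard n.+1]. *)
Lemma fixpointE i p : fixpoint i p = U0 i p + kernel_op fixpoint i p.
Proof.
have h : picard n.+1 i p @[n --> \oo] --> U0 i p + kernel_op fixpoint i p.
  apply: cvgeD => //.
  - apply: ge0_adde_def; rewrite inE; first exact: (mU0 i).2.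
    exact: (mnn_kernel_op i mnn_fixpoint).2.
  - exact: cvg_cst.
  - apply: kernel_op_cvg; [exact: mnn_picard|exact: nondecreasing_picard|exact: picard_cvg].
have := @picard_cvg i p; rewrite -cvg_shiftS => h'.
by rewrite -(cvg_lim _ h') // (cvg_lim _ h).
Qed.

End positive_fixpoint.

(** * Smallness of the exponentially damped kernel *)

Section weight.
Context {R : realType}.
Notation R3 := (@R3 R).
Variables (T : R).
Hypothesis T_gt0 : 0 < T.

Let mnn_damped (g : R) (d : measure_display) (X : measurableType d) (f : X -> R3) :
  measurable_fun setT f ->
  mnn (fun x => (ball_ker T (f x))%:E * (expR (- (g * norm3 (f x))))%:E)%E.
Proof.
move=> mf; apply: mnnM; first exact: mnn_ball_ker.
apply: mnn_EFin => [|x]; last exact: expR_ge0.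
apply: (measurableT_comp (f := @expR R)); first exact: measurable_expR.
by apply: measurable_funN; mfun.
Qed.

(** At the origin the damping factor is 1 for every rate, so the pointwise convergence to 0 used
    next needs this null set removed. *)
Let leb3_0 : {ae @leb3 R, forall z, norm3 z != 0}.
Proof.
pose O : set R := [set 0].
have mO : measurable O by exact: measurable_set1.
exists ((O `*` O) `*` O); split.
- by apply: measurableX => //; exact: measurableX.
- transitivity (@leb2 R (O `*` O) * @lebesgue_measure R O)%E.
    apply: (product_measure1E (@leb2 R) (@lebesgue_measure R)) => //.
    exact: measurableX.
  by rewrite lebesgue_measure_set1 mule0.
- move=> z /= /negP; rewrite negbK => /eqP z0.
  by have [] := coord_le_norm3 z; rewrite z0 !normr_le0 => /eqP -> /eqP -> /eqP ->.
Qed.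

(** Dominated convergence, with the integrable [ball_ker T] as dominating function. *)
Let damped_cvg0 : (\int[leb3]_z ((ball_ker T z)%:E
  * (expR (- (n%:R * norm3 z)))%:E) @[n --> \oo] --> 0)%E.
Proof.
have mb := @mnn_ball_ker R T _ _ (fun z : R3 => z) (@measurable_id _ _ _).
pose f_ (n : nat) z := ((ball_ker T z)%:E * (expR (- (n%:R * norm3 z)))%:E)%E.
have mf n : mnn (f_ n) by apply: (@mnn_damped _ _ _ (fun z => z)); mfun.
have := @dominated_convergence _ _ R (@leb3 R) setT measurableT f_ (cst 0%E)
  (fun z => (ball_ker T z)%:E).
case=> //.
- by move=> n; exact: (mf n).1.
- apply: (ae_imp (m := @leb3 R)) leb3_0 => z z0 _.
  rewrite /cst /= -(mule0 (ball_ker T z)%:E); apply: cvgeZl => //.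
  apply: cvg_EFin; first exact: nearW.
  have zp : 0 < norm3 z by rewrite lt_neqAle eq_sym z0 norm3_ge0.
  apply/cvgrPdist_lt => e e0; near=> n.
  rewrite /= sub0r normrN ger0_norm ?expR_ge0// -[ltRHS]lnK ?posrE// ltr_expR.
  rewrite ltrNl -ltr_pdivrMr//.
  by near: n; exact: nbhs_infty_gtr.
- apply/integrableP; split; first exact: mb.1.
  rewrite (_ : integral _ _ _ = \int[leb3]_z (ball_ker T z)%:E)%E.
    exact: integral_ball_ker_fin.
  by apply: eq_integral => z _; rewrite gee0_abs// lee_fin ball_ker_ge0.
- apply: aeW => z n _; rewrite gee0_abs; last exact: (mf n).2.
  rewrite /f_ -EFinM lee_fin ler_piMr ?ball_ker_ge0// -expR0 ler_expR.
  by rewrite oppr_le0 mulr_ge0 ?norm3_ge0.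
- by move=> _ _; rewrite integral_cst//= mul0e.
Unshelve. all: by end_near. Qed.

(** The integral over R^6 factors as I^2 with I the damped integral over R^3. Once I < 1/(2(c+1)),
    one gets c I^2 <= c/(4(c+1)^2) <= 1/4; writing c+1 keeps the threshold meaningful at c = 0. *)
Lemma exists_damping (c : R) : 0 <= c -> exists2 g : R, 0 <= g &
  (c%:E * \int[leb6]_z ((ball_ker T z.1 * ball_ker T z.2)%:E
     * (expR (- (g * norm3 z.1 + g * norm3 z.2)))%:E) <= (1/4)%:E)%E.
Proof.
move=> c0; have e0 : 0 < (2 * (c + 1))^-1 by rewrite invr_gt0; lra.
have /fine_cvgP[[N1 _ fin] /cvgrPdist_lt/(_ _ e0)[N2 _ small]] := damped_cvg0.
pose n := maxn N1 N2; exists n%:R => //.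
pose I := fine (\int[leb3]_z ((ball_ker T z)%:E * (expR (- (n%:R * norm3 z)))%:E))%E.
have IE : (\int[leb3]_z ((ball_ker T z)%:E * (expR (- (n%:R * norm3 z)))%:E))%E = I%:E.
  by rewrite /I fineK//; apply: fin => /=; exact: leq_maxl.
have I0 : 0 <= I.
  by apply: fine_ge0; apply: integral_ge0 => z _; apply: mule_ge0; rewrite lee_fin ?ball_ker_ge0 ?expR_ge0.
have Is : I < (2 * (c + 1))^-1.
  have := small n (leq_maxr _ _).
  by rewrite /= sub0r normrN -/I ger0_norm.
have -> : (\int[leb6]_z ((ball_ker T z.1 * ball_ker T z.2)%:E
     * (expR (- (n%:R * norm3 z.1 + n%:R * norm3 z.2)))%:E) = I%:E * I%:E)%E.
  pose D (z : R3) := ((ball_ker T z)%:E * (expR (- (n%:R * norm3 z)))%:E)%E.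
  have mD (f : R3 * R3 -> R3) : measurable_fun setT f -> mnn (fun z => D (f z)).
    exact: mnn_damped.
  transitivity (\int[leb6]_z (D z.1 * D z.2))%E.
    apply: eq_integral => z _; rewrite /D muleACA -!EFinM; congr (_ * _)%:E.
    by rewrite -expRD opprD.
  have mD0 : mnn D by apply: (@mnn_damped _ _ _ (fun z => z)); mfun.
  rewrite integral_leb6; last by apply: mnnM; apply: mD; mfun.
  under eq_integral => x _ do rewrite /= mnn_integralZl ?IE ?(mD0.2)// muleC.
  by rewrite /= mnn_integralZl ?IE ?lee_fin.
rewrite -!EFinM lee_fin.
have h : I * (2 * (c + 1)) < 1 by rewrite -ltr_pdivlMr ?mul1r//; lra.
have h0 : 0 <= I * (2 * (c + 1)) by rewrite mulr_ge0//; lra.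
have : I * (2 * (c + 1)) * (I * (2 * (c + 1))) <= 1 by nra.
have : 0 <= I * I * (c * c + c + 1) by rewrite mulr_ge0 ?mulr_ge0//; nra.
nra.
Qed.

End weight.

(** * Contraction in exponentially weighted norms *)

Section contraction.
Context {R : realType}.
Notation R3 := (@R3 R).
Notation E := (R * R)%type.
Notation X6 := (R3 * R3)%type.
Variables T B : R.
Hypotheses (T_gt0 : 0 < T) (B_ge0 : 0 <= B).

(** An exponential of a linear form: retarding the times by z multiplies it by a factor that depends
    on z only, see [growth_retard]. *)
Definition growth (g : R) (e : E) : R := expR (g * (e.1 + e.2)).

Lemma growth_gt0 g e : 0 < growth g e. Proof. exact: expR_gt0. Qed.

Lemma measurable_growth g : measurable_fun setT (growth g).
Proof.
apply: (measurableT_comp (f := @expR R)); first exact: measurable_expR.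
by mfun.
Qed.

Lemma growth_retard g e z :
  growth g (retard e z) = growth g e * expR (- (g * norm3 z.1 + g * norm3 z.2)).
Proof. by rewrite /growth /retard -expRD /=; congr expR; ring. Qed.

Lemma mnn_ball_ker2 : mnn (fun z : X6 => (ball_ker T z.1 * ball_ker T z.2)%:E).
Proof.
under eq_fun => q do rewrite EFinM.
by apply: mnnM; apply: mnn_ball_ker; mfun.
Qed.

Lemma mnn_damping g : mnn (fun z : X6 =>
  ((ball_ker T z.1 * ball_ker T z.2)%:E
     * (expR (- (g * norm3 z.1 + g * norm3 z.2)))%:E)%E).
Proof.
apply: mnnM; first exact: mnn_ball_ker2.
apply: mnn_EFin => [|z]; last exact: expR_ge0.
apply: (measurableT_comp (f := @expR R)); first exact: measurable_expR.
by apply: measurable_funN; mfun.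
Qed.

(** One rate serves both forms. In the first, the weight at the retarded times is [growth g e] times
    the damping, and the former leaves the integral. In the second, Tonelli puts the times inside,
    where for fixed z they can be translated. *)
Lemma maj_op_contraction : exists2 g : R, 0 <= g &
  (forall G (M : R), mnn G -> 0 <= M ->
    (forall e, sqnorm G e <= (M * growth g e)%:E)%E ->
    forall e, (sqnorm (maj_op T B G) e <= (M / 4 * growth g e)%:E)%E) /\
  (forall G, mnn G ->
    (\int[leb2]_e ((growth (- g) e)%:E * sqnorm (maj_op T B G) e)
      <= (1/4)%:E * \int[leb2]_e ((growth (- g) e)%:E * sqnorm G e))%E).
Proof.
have [c c0 key] := sqnorm_maj_op T_gt0 B_ge0.
have [g g0 small] := exists_damping T_gt0 c0.
have mbk := mnn_ball_ker2; have mdp := mnn_damping g.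
have mwN h : mnn (fun e : E => (growth h e)%:E).
  apply: mnn_EFin => [|e]; first exact: measurable_growth.
  exact: ltW (growth_gt0 _ _).
have mret G : mnn G -> mnn (fun q : E * X6 => sqnorm G (retard q.1 q.2)).
  by move=> mG; apply: mnn_comp (mnn_sqnorm mG); mfun.
exists g => //; split=> [G M mG M0 hG e|G mG].
  apply: (le_trans (key G e mG)).
  apply: (@le_trans _ _ (c%:E * \int[leb6]_z ((M * growth g e)%:E *
     ((ball_ker T z.1 * ball_ker T z.2)%:E
     * (expR (- (g * norm3 z.1 + g * norm3 z.2)))%:E)))%E).
    rewrite lee_pmul ?lee_fin//.
      apply: integral_ge0 => z _; apply: mule_ge0; first exact: mbk.2.
      exact: (mnn_sqnorm mG).2.
    apply: mnn_integral_le => [||z].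
    - exact: mnnM mbk (mnn_pair1 e (mret G mG)).
    - apply: mnnM => //; apply: mnn_cst.
      by rewrite lee_fin mulr_ge0// ltW// growth_gt0.
    - rewrite muleCA; apply: lee_pmul => //.
      + exact: mbk.2.
      + exact: (mnn_sqnorm mG).2.
      + by rewrite -EFinM -mulrA -growth_retard; exact: hG.
  have Mw0 : (0 <= (M * growth g e)%:E)%E.
    by rewrite lee_fin mulr_ge0// ltW// growth_gt0.
  rewrite mnn_integralZl// muleCA.
  apply: (le_trans (lee_wpmul2l Mw0 small)).
  by rewrite -EFinM lee_fin; rewrite le_eqVlt; apply/orP; left; apply/eqP; field.
pose A := (\int[leb2]_e ((growth (- g) e)%:E * sqnorm G e))%E.
have A0 : (0 <= A)%E.
  apply: integral_ge0 => e _; apply: mule_ge0; first exact: (mwN _).2.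
  exact: (mnn_sqnorm mG).2.
pose F (q : E * X6) := ((growth (- g) q.1)%:E *
  ((ball_ker T q.2.1 * ball_ker T q.2.2)%:E * sqnorm G (retard q.1 q.2)))%E.
have mF : mnn F.
  apply: mnnM; first by apply: mnn_comp (mwN _); mfun.
  apply: mnnM; last exact: mret.
  by apply: mnn_comp mbk; mfun.
apply: (@le_trans _ _ (\int[leb2]_e (c%:E * \int[leb6]_z F (e, z)))%E).
  apply: mnn_integral_le => [||e].
  - exact: mnnM (mwN _) (mnn_sqnorm (mnn_maj_op T B_ge0 mG)).
  - by apply: mnnM; [exact: mnn_cst|exact: (mnn_integral (@leb6 R) mF)].
  - rewrite /F /= mnn_integralZl; last 2 first.
    + exact: mnnM mbk (mnn_pair1 e (mret G mG)).
    + exact: (mwN _).2.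
    by rewrite muleCA lee_wpmul2l ?lee_fin ?(ltW (growth_gt0 _ _))//; exact: key.
rewrite mnn_integralZl ?lee_fin//; last exact: (mnn_integral (@leb6 R) mF).
rewrite (mnn_tonelli (@leb2 R) (@leb6 R) mF).
rewrite (_ : (\int[leb6]_z \int[leb2]_e F (e, z)
    = \int[leb6]_z (A * ((ball_ker T z.1 * ball_ker T z.2)%:E
     * (expR (- (g * norm3 z.1 + g * norm3 z.2)))%:E)))%E).
  rewrite mnn_integralZl// muleCA.
  by apply: (le_trans (lee_wpmul2l A0 small)); rewrite muleC.
apply: eq_integral => z _.
have [_ tr] := preserves_translate2 (norm3 z.1, norm3 z.2).
pose S e := ((growth (- g) e)%:E * sqnorm G e)%E.
have mS : mnn S by exact: mnnM (mwN _) (mnn_sqnorm mG).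
pose w1 : \bar R := ((ball_ker T z.1 * ball_ker T z.2)%:E
     * (expR (- (g * norm3 z.1 + g * norm3 z.2)))%:E)%E.
have w10 : (0 <= w1)%E by exact: mdp.2.
(* The weight exp(-g (e1+e2)) equals its value at the retarded times multiplied by exp(-g
   (|z1|+|z2|)); translation invariance then removes the retardation. *)
transitivity (\int[leb2]_e (w1 * S (retard e z)))%E; last first.
  apply: etrans (tr (fun e => (w1 * S e)%E) (mnnM (mnn_cst _ w10) mS)) _.
  exact: etrans (mnn_integralZl (@leb2 R) mS w10) (muleC _ _).
apply: eq_integral => e _; rewrite /F /S /w1 /= growth_retard.
rewrite !muleA; congr (_ * _)%E; rewrite -!EFinM; congr _%:E.
set b1 := ball_ker T z.1; set b2 := ball_ker T z.2.
rewrite !mulNr -opprD opprK expRN.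
by field; rewrite gt_eqF// expR_gt0.
Qed.

End contraction.


(** * Norm bounds for the fixed point, and vanishing of subsolutions *)

Section solve_positive.
Context {R : realType}.
Notation R3 := (@R3 R).
Notation E := (R * R)%type.
Notation X6 := (R3 * R3)%type.
Variables T B : R.
Hypotheses (T_gt0 : 0 < T) (B_ge0 : 0 <= B).

Let sqr_add_le (a b : \bar R) : (0 <= a)%E -> (0 <= b)%E ->
  ((a + b) * (a + b) <= 2%:E * (a * a) + 2%:E * (b * b))%E.
Proof.
case: a => [a||]//; case: b => [b||]// a0 b0.
- rewrite -!(EFinD, EFinM) lee_fin; have := sqr_ge0 (a - b); nra.
- by rewrite !mulyy gt0_muley ?lte_fin// addey ?leey// -!EFinM.
- by rewrite !mulyy gt0_muley ?lte_fin// addye ?leey// -!EFinM.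
- by rewrite !mulyy gt0_muley ?lte_fin// leey.
Qed.

Lemma sqnorm_le (F G : E * X6 -> \bar R) e : mnn F -> mnn G ->
  {ae leb6, forall x, (F (e, x) <= G (e, x))%E} -> (sqnorm F e <= sqnorm G e)%E.
Proof.
move=> mF mG FG; apply: mnn_integral_ae_le.
- by have := mnn_pair1 e mF => m; exact: mnnM.
- by have := mnn_pair1 e mG => m; exact: mnnM.
- apply: (ae_imp (m := @leb6 R)) FG => x h; apply: lee_pmul => //; exact: mF.2.
Qed.

Lemma sqnormD_le (F G : E * X6 -> \bar R) e : mnn F -> mnn G ->
  (sqnorm (fun p => F p + G p) e <= 2%:E * sqnorm F e + 2%:E * sqnorm G e)%E.
Proof.
move=> mF mG; rewrite /sqnorm.
have mFe := mnn_pair1 e mF; have mGe := mnn_pair1 e mG.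
have m2 (H : X6 -> \bar R) : mnn H -> mnn (fun x => 2%:E * (H x * H x))%E.
  by move=> mH; apply: mnnM; [exact: mnn_cst|exact: mnnM].
have two_ge0 : (0 <= 2%:E :> \bar R)%E by rewrite lee_fin.
rewrite -(mnn_integralZl (@leb6 R) (mnnM mFe mFe) two_ge0).
rewrite -(mnn_integralZl (@leb6 R) (mnnM mGe mGe) two_ge0).
rewrite -(mnn_integralD (@leb6 R) (m2 _ mFe) (m2 _ mGe)).
apply: mnn_integral_le => [||x].
- by have := mnnD mFe mGe => m; exact: mnnM.
- by apply: mnnD; exact: m2.
- by apply: sqr_add_le; [exact: mF.2|exact: mG.2].
Qed.

Definition retard_point (q : (E * X6) * X6) : E * X6 :=
  (retard q.1.1 (sub6 q.1.2 q.2), q.2).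

Lemma measurable_retard_point : measurable_fun setT retard_point.
Proof. by rewrite /retard_point; mfun. Qed.

Section fixpoint_bound.
Variables (I : finType) (k : I -> I -> (E * X6) * X6 -> R).
Hypothesis mk : forall i j, measurable_fun setT (k i j).
Hypothesis k0 : forall i j q, 0 <= k i j q.
Hypothesis k_maj : forall j q, \sum_i k i j q <= maj_ker T B q.1.1 q.1.2 q.2.

(** [k_maj] bounds column sums: each input j is spread over all outputs i with total weight at most
    [maj_ker]. Adding the components therefore reduces the system to the scalar majorant. *)
Lemma sum_kernel_op_le V p : (forall i, mnn (V i)) ->
  (\sum_i kernel_op leb6 k retard_point V i p
    <= maj_op T B (fun q => \sum_i V i q) p)%E.
Proof.
move=> mV; rewrite /kernel_op /maj_op.
have mi i := mnn_pair1 p (mnn_kernel_integrand mk k0 measurable_retard_point i mV).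
rewrite -(ge0_integral_sum (@leb6 R) measurableT); last 2 first.
  by move=> i; exact: (mi i).1.
  by move=> i y _; exact: (mi i).2.
apply: mnn_integral_le => [||y].
- exact: mnn_sum.
- have mS : mnn (fun q => \sum_i V i q)%E by exact: mnn_sum.
  exact: (mnn_pair1 p (mnn_maj_integrand T B_ge0 mS)).
- rewrite exchange_big/= ge0_sume_distrr; last by move=> i _; exact: (mV i).2.
  apply: lee_sum => j _; rewrite -ge0_sume_distrl; last by move=> i _; rewrite lee_fin.
  apply: lee_pmul => //; [|exact: (mV j).2|].
    by apply: sume_ge0 => i _; rewrite lee_fin.
  by rewrite sumEFin lee_fin; exact: (k_maj j (p, y)).
Qed.

Variable (U0 : I -> E * X6 -> \bar R) (M : R).
Hypotheses (mU0 : forall i, mnn (U0 i)) (M_ge0 : 0 <= M).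
Hypothesis U0_bound : forall e, in_square T e ->
  (sqnorm (fun q => \sum_i U0 i q) e <= M%:E)%E.
Hypothesis U0_support : forall e x i, ~~ in_square T e -> U0 i (e, x) = 0%E.

Notation U := (fixpoint (@leb6 R) k retard_point U0).

(** By (F+G)^2 <= 2F^2 + 2G^2 and the contraction factor 1/4, the bound 4M reproduces itself along
    the iteration: 2M + 2 (4M)/4 = 4M. It passes to the limit by monotone convergence. The bound on
    [maj_op] is kept as well, since it is the source of integrability later. *)
Lemma sqnorm_fixpoint_le : exists M' : R, forall e,
  e.1 <= T -> e.2 <= T -> (sqnorm (fun q => \sum_i U i q) e <= M'%:E)%E /\
    (sqnorm (maj_op T B (fun q => \sum_i U i q)) e <= M'%:E)%E.
Proof.
have [g g0 [contr _]] := maj_op_contraction T_gt0 B_ge0.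
pose W n q := (\sum_i picard (@leb6 R) k retard_point U0 n i q)%E.
have mp n i := mnn_picard (@leb6 R) mk k0 measurable_retard_point mU0 n i.
have mW n : mnn (W n) by apply: mnn_sum => i; exact: mp.
have W0 e : (sqnorm (fun q => \sum_i U0 i q) e <= (M * growth g e)%:E)%E.
  have [eQ|eQ] := boolP (in_square T e).
    apply: (le_trans (U0_bound eQ)); rewrite lee_fin ler_peMr//.
    move: eQ => /andP[/andP[e1 _] /andP[e2 _]].
    by rewrite /growth -expR0 ler_expR mulr_ge0// addr_ge0// ltW.
  rewrite (_ : sqnorm _ _ = 0%E); first by rewrite lee_fin mulr_ge0// ltW// growth_gt0.
  apply: integral0_eq => x _; rewrite big1 ?mul0e// => i _.
  exact: U0_support.
have bound n e : (sqnorm (W n) e <= (4 * M * growth g e)%:E)%E.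
  elim: n e => [|n IH] e.
    apply: (le_trans (W0 e)); rewrite lee_fin ler_wpM2r ?(ltW (growth_gt0 _ _))//.
    by rewrite ler_peMl// ler1n.
  have mP : mnn (maj_op T B (W n)) by exact: mnn_maj_op.
  have mS0 : mnn (fun q => \sum_i U0 i q)%E by exact: mnn_sum.
  apply: (@le_trans _ _ (sqnorm (fun q => (\sum_i U0 i q) + maj_op T B (W n) q)%E e)).
    apply: sqnorm_le => //; first exact: mnnD.
    apply: (aeW (@leb6 R)) => x; rewrite /W /= big_split/= leeD2l//.
    by apply: sum_kernel_op_le => i; exact: mp.
  apply: (le_trans (sqnormD_le _ mS0 mP)).
  have M4 : 0 <= 4 * M by rewrite mulr_ge0.
  have h := contr (W n) (4 * M) (mW n) M4 IH e.
  apply: (@le_trans _ _ (2%:E * (M * growth g e)%:E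
      + 2%:E * (4 * M / 4 * growth g e)%:E)%E).
    by rewrite leeD// lee_wpmul2l.
  by rewrite -!EFinM -EFinD lee_fin; rewrite le_eqVlt; apply/orP; left; apply/eqP; field.
have M4 : 0 <= 4 * M by rewrite mulr_ge0.
have ndW q : nondecreasing_seq (W ^~ q).
  move=> n1 n2 n12; apply: lee_sum => i _.
  exact: (nondecreasing_picard (@leb6 R) mk k0 measurable_retard_point mU0).
have cW q : W n q @[n --> \oo] --> (\sum_i U i q)%E.
  apply: cvg_nnesum => i _; first by apply: nearW => n; exact: (mp n i).2.
  exact: (picard_cvg (m := @leb6 R) mk k0 measurable_retard_point mU0).
have lim e : sqnorm (W n) e @[n --> \oo] --> sqnorm (fun q => \sum_i U i q)%E e.
  apply: (mnn_cvg (@leb6 R) (f := fun n x => (W n (e, x) * W n (e, x))%E) _ _ _).2.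
  - by move=> n; have := mnn_pair1 e (mW n) => m; exact: mnnM.
  - move=> x n1 n2 n12; have w0 n := (mW n).2 (e, x).
    by apply: lee_pmul => //; exact: ndW.
  - move=> x; apply: cvgeM; [|exact: (cW (e, x))|exact: (cW (e, x))].
    have U_ge0 : (0 <= \sum_i U i (e, x))%E.
      apply: sume_ge0 => i _.
      exact: (mnn_fixpoint (@leb6 R) mk k0 measurable_retard_point mU0 i).2.
    by move: U_ge0; case: (\sum_i U i (e, x))%E.
have mU : mnn (fun q => \sum_i U i q)%E.
  by apply: mnn_sum => i; have := mnn_fixpoint (@leb6 R) mk k0 measurable_retard_point mU0 i.
have U_bound e : (sqnorm (fun q => \sum_i U i q) e <= (4 * M * growth g e)%:E)%E.
  by apply: cvge_le (lim e); apply: nearW => n; exact: bound.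
exists (4 * M * expR (g * (T + T))) => e e1 e2.
have ge : growth g e <= expR (g * (T + T)).
  by rewrite /growth ler_expR ler_wpM2l// lerD.
split; [apply: (le_trans (U_bound e))|apply: (le_trans (contr _ _ mU M4 U_bound e))];
  rewrite lee_fin; first by rewrite ler_wpM2l.
by apply: ler_pM => //; [rewrite divr_ge0|exact: ltW (growth_gt0 _ _)|lra].
Qed.

End fixpoint_bound.

(** The time-integrated weighted norm A of [D] satisfies A <= A/4. It is finite because [D] lives on
    a bounded square of times with bounded norms there, hence it is 0. *)
Lemma maj_op_unique (D : E * X6 -> \bar R) (M : R) : mnn D ->
  (forall e x, ~~ in_square T e -> D (e, x) = 0%E) ->
  {ae leb2, forall e, in_square T e -> (sqnorm D e <= M%:E)%E} ->
  {ae leb2, forall e, in_square T e ->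
    {ae leb6, forall x, (D (e, x) <= maj_op T B D (e, x))%E}} ->
  {ae leb2, forall e, {ae leb6, forall x, D (e, x) = 0%E}}.
Proof.
move=> mD D0 Dbound Dle.
have [g g0 [_ contr]] := maj_op_contraction T_gt0 B_ge0.
have mP : mnn (maj_op T B D) by exact: mnn_maj_op.
have mw : mnn (fun e : E => (growth (- g) e)%:E).
  apply: mnn_EFin => [|e]; first exact: measurable_growth.
  exact: ltW (growth_gt0 _ _).
have msq := mnn_sqnorm mD.
have sq0 e : ~~ in_square T e -> sqnorm D e = 0%E.
  by move=> eQ; apply: integral0_eq => x _; rewrite D0// mul0e.
pose A := (\int[leb2]_e ((growth (- g) e)%:E * sqnorm D e))%E.
have A0 : (0 <= A)%E.
  by apply: integral_ge0 => e _; apply: mule_ge0; [exact: mw.2|exact: msq.2].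
have A1 : (A <= (1/4)%:E * A)%E.
  apply: le_trans (contr D mD); apply: mnn_integral_ae_le.
  - exact: mnnM.
  - by apply: mnnM => //; exact: mnn_sqnorm.
  - apply: (ae_imp (m := @leb2 R)) Dle => e he; apply: lee_wpmul2l; first exact: mw.2.
    have [eQ|eQ] := boolP (in_square T e); first by apply: sqnorm_le => //; exact: he.
    by rewrite sq0//; exact: (mnn_sqnorm mP).2.
have Afin : (A < +oo)%E.
  pose I : set R := `]0, T]%classic.
  have mI : measurable I by exact: measurable_itv.
  pose Q : set E := I `*` I.
  have mQ : measurable Q by exact: measurableX.
  have mind : mnn (fun e : E => (\1_Q e : R)%:E).
    by apply: mnn_EFin => //; exact: measurable_indic.
  (* On the square the weight is at most 1. The absolute value keeps the dominating function
     nonnegative, as [M] has no sign here. *)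
  apply: (@le_lt_trans _ _ (\int[leb2]_e (`|M|%:E * (\1_Q e : R)%:E))%E).
    apply: mnn_integral_ae_le; first exact: mnnM.
      by apply: mnnM => //; apply: mnn_cst; rewrite lee_fin.
    apply: (ae_imp (m := @leb2 R)) Dbound => e he.
    have [eQ|eQ] := boolP (in_square T e); last first.
      by rewrite sq0// mule0 -EFinM lee_fin mulr_ge0.
    have -> : \1_Q e = 1 :> R.
      rewrite indicE mem_set//; move: eQ => /andP[e1 e2].
      by split; rewrite /I /= in_itv.
    rewrite mule1 -[leRHS]mul1e; apply: lee_pmul; [exact: mw.2|exact: msq.2| |].
      move: eQ => /andP[/andP[e1 _] /andP[e2 _]].
      rewrite lee_fin /growth -expR0 ler_expR mulNr oppr_le0 mulr_ge0// addr_ge0 ?ltW//.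
    by apply: (le_trans (he eQ)); rewrite lee_fin ler_norm.
  rewrite mnn_integralZl ?lee_fin//.
  have -> : (\int[leb2]_e (\1_Q e : R)%:E = leb2 Q)%E.
    by rewrite integral_indic// setIT.
  have -> : leb2 Q = (lebesgue_measure I * lebesgue_measure I)%E.
    by apply: (product_measure1E (@lebesgue_measure R) (@lebesgue_measure R)).
  have -> : lebesgue_measure I = T%:E.
    by rewrite lebesgue_measure_itv/= lte_fin T_gt0 -EFinB subr0.
  by rewrite -!EFinM ltry.
have Az : A = 0%E.
  move: A0 A1 Afin; case: A => [r||]//; rewrite -EFinM !lee_fin => r0 r1 _.
  by congr _%:E; lra.
have := mnn_integral_eq0 (m := @leb2 R) (mnnM mw msq) Az.
apply: (ae_imp (m := @leb2 R)) => e /eqP.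
rewrite mule_eq0 eqe gt_eqF ?growth_gt0//= => /eqP sqe.
have mDe := mnn_pair1 e mD.
have := mnn_integral_eq0 (m := @leb6 R) (mnnM mDe mDe) sqe.
by apply: (ae_imp (m := @leb6 R)) => x /eqP; rewrite mule_eq0 orbb => /eqP.
Qed.

End solve_positive.

(** * Real systems with signed kernels *)

Section signed_system.
Context {R : realType}.
Notation R3 := (@R3 R).
Notation E := (R * R)%type.
Notation X6 := (R3 * R3)%type.
Variables T B : R.
Hypotheses (T_gt0 : 0 < T) (B_ge0 : 0 <= B).
Variables (I : finType) (k : I -> I -> (E * X6) * X6 -> R).
Hypothesis mk : forall i j, measurable_fun setT (k i j).
Hypothesis k_maj : forall j q, \sum_i `|k i j q| <= maj_ker T B q.1.1 q.1.2 q.2.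
Variables (phi0 : I -> E * X6 -> R) (M : R).
Hypotheses (mphi0 : forall i, measurable_fun setT (phi0 i)) (M_ge0 : 0 <= M).
Hypothesis phi0_support : forall e x i, ~~ in_square T e -> phi0 i (e, x) = 0.
Hypothesis phi0_bound : forall e, in_square T e ->
  (sqnorm (fun q => (\sum_i `|phi0 i q|)%:E) e <= M%:E)%E.

Definition sign_part (b : bool) (t : R) : R :=
  if b then Num.max t 0 else Num.max (- t) 0.

Lemma sign_part_ge0 b t : 0 <= sign_part b t.
Proof. by rewrite /sign_part; case: b; rewrite le_max lexx orbT. Qed.

Lemma sign_partB t : sign_part true t - sign_part false t = t.
Proof.
rewrite /sign_part; have [t0|t0] := leP 0 t.
  by rewrite [X in _ - X](_ : _ = 0) ?subr0//; apply/max_idPr; rewrite oppr_le0.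
by rewrite [X in _ - X](_ : _ = - t) ?sub0r ?opprK//; apply/max_idPl; rewrite oppr_ge0 ltW.
Qed.

Lemma sign_partD t : sign_part true t + sign_part false t = `|t|.
Proof.
have := sign_partB t; rewrite /sign_part; have [t0|t0] := leP 0 t => _.
  rewrite ger0_norm// [X in _ + X](_ : _ = 0) ?addr0//.
  by apply/max_idPr; rewrite oppr_le0.
rewrite ltr0_norm// [X in _ + X](_ : _ = - t) ?add0r//.
by apply/max_idPl; rewrite oppr_ge0 ltW.
Qed.

Lemma measurable_sign_part (d : measure_display) (X : measurableType d) b
    (f : X -> R) : measurable_fun setT f ->
  measurable_fun setT (fun x => sign_part b (f x)).
Proof.
move=> mf; rewrite /sign_part; case: b; apply: measurable_maxr => //.
exact: measurable_funN.
Qed.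

Notation J := (I * bool)%type.

(* Splitting every component into its positive and negative parts turns the
   signed system into one with nonnegative kernels: like signs feed the
   positive part of a kernel, opposite signs its negative part. *)
Definition sign_kernel (i j : J) (q : (E * X6) * X6) : R :=
  sign_part (i.2 == j.2) (k i.1 j.1 q).

Definition sign_datum (i : J) (q : E * X6) : \bar R :=
  (sign_part i.2 (phi0 i.1 q))%:E.

Lemma sum_sign (F : J -> R) : \sum_i F i = \sum_i (F (i, true) + F (i, false)).
Proof.
rewrite (eq_bigr (fun i => F (i.1, i.2))); last by case.
rewrite -(pair_bigA _ (fun i b => F (i, b))) /=.
by apply: eq_bigr => i _; rewrite big_bool.
Qed.

Let mK i j : measurable_fun setT (sign_kernel i j).
Proof. exact: measurable_sign_part. Qed.

Let K0 i j q : 0 <= sign_kernel i j q. Proof. exact: sign_part_ge0. Qed.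

Let Kmaj j q : \sum_i sign_kernel i j q <= maj_ker T B q.1.1 q.1.2 q.2.
Proof.
apply: le_trans (k_maj j.1 q); rewrite sum_sign; apply: ler_sum => i _.
rewrite /sign_kernel /= -sign_partD; case: j.2 => //=.
by rewrite [leRHS]addrC.
Qed.

Let mU0 i : mnn (sign_datum i).
Proof.
apply: mnn_EFin => [|q]; last exact: sign_part_ge0.
exact: measurable_sign_part.
Qed.

Let U := fixpoint (@leb6 R) sign_kernel retard_point sign_datum.

Let mU i : mnn (U i).
Proof. by have := mnn_fixpoint (@leb6 R) mK K0 measurable_retard_point mU0 i. Qed.

Let G q : \bar R := (\sum_i U i q)%E.

Let mG : mnn G. Proof. exact: mnn_sum. Qed.

Let U_le_G i q : (U i q <= G q)%E.
Proof.
rewrite /G (bigD1 i)//= leeDl//; apply: sume_ge0 => j _; exact: (mU j).2.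
Qed.

Let G_bound : exists M' : R, forall e, in_square T e ->
  (sqnorm G e <= M'%:E)%E /\ (sqnorm (maj_op T B G) e <= M'%:E)%E.
Proof.
have U0_supp e x i : ~~ in_square T e -> sign_datum i (e, x) = 0%E.
  by move=> eQ; rewrite /sign_datum phi0_support// /sign_part oppr0 maxxx; case: ifP.
have U0_bd e : in_square T e -> (sqnorm (fun q => \sum_i sign_datum i q) e <= M%:E)%E.
  move=> eQ; rewrite (_ : (fun q => _) = (fun q => (\sum_i `|phi0 i q|)%:E)).
    exact: phi0_bound.
  apply/funext => q; rewrite sumEFin; congr _%:E; rewrite sum_sign.
  by apply: eq_bigr => i _; rewrite sign_partD.
have [M' HM] := sqnorm_fixpoint_le T_gt0 B_ge0 mK K0 Kmaj mU0 M_ge0 U0_bd U0_supp.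
by exists M' => e /andP[/andP[_ e1] /andP[_ e2]]; exact: HM.
Qed.

Let sqnorm_lty (F : E * X6 -> \bar R) e (M' : R) : mnn F -> (sqnorm F e <= M'%:E)%E ->
  {ae leb6, forall x, (F (e, x) < +oo)%E}.
Proof.
move=> mF Fe; have mFe := mnn_pair1 e mF.
have := mnn_integral_lty (m := @leb6 R) (mnnM mFe mFe) (le_lt_trans Fe (ltry _)).
apply: (ae_imp (m := @leb6 R)) => x; have := mF.2 (e, x).
by case: (F (e, x)) => [r||]// _; rewrite ?ltry// mulyy.
Qed.

(** [fine] sends [+oo] to 0, so this is a real function everywhere; it is the true difference
    wherever both sign parts are finite, thus for almost every x at each time of the square. *)
Definition signed_fixpoint (i : I) (q : E * X6) : R :=
  fine (U (i, true) q) - fine (U (i, false) q).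

Let mfU i : measurable_fun setT (fun q => fine (U i q)).
Proof. by apply: measurableT_comp (mU i).1; exact: fine_measurable. Qed.

Lemma measurable_signed_fixpoint i : measurable_fun setT (signed_fixpoint i).
Proof. by apply: measurable_fun_sub; exact: mfU. Qed.

Let fine_le (u : \bar R) : (0 <= u)%E -> ((fine u)%:E <= u)%E.
Proof. by case: u => [u||]//= _; rewrite leey. Qed.

Let fU0 i q : 0 <= fine (U i q). Proof. by apply: fine_ge0; exact: (mU i).2. Qed.

Let sum_signed_le q : ((\sum_i `|signed_fixpoint i q|)%:E <= G q)%E.
Proof.
apply: (@le_trans _ _ (\sum_i fine (U i q))%:E).
  rewrite lee_fin sum_sign; apply: ler_sum => i _.
  by rewrite (le_trans (ler_normB _ _))// !ger0_norm.
by rewrite -sumEFin; apply: lee_sum => i _; apply: fine_le; exact: (mU i).2.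
Qed.

Lemma signed_fixpoint_bound : exists M' : R, forall e, in_square T e ->
  (sqnorm (fun q => (\sum_i `|signed_fixpoint i q|)%:E) e <= M'%:E)%E.
Proof.
have [M' HM] := G_bound; exists M' => e eQ.
apply: le_trans (HM e eQ).1; apply: sqnorm_le => //.
  apply: mnn_EFin => [|q]; last exact: sumr_ge0.
  apply: measurable_sum => i; apply: measurableT_comp => //.
  exact: measurable_signed_fixpoint.
by apply: (aeW (@leb6 R)) => x; exact: sum_signed_le.
Qed.

Let integrable_maj (p : E * X6) (kap : X6 -> R) (g : E * X6 -> R) :
  (maj_op T B G p < +oo)%E -> measurable_fun setT kap -> measurable_fun setT g ->
  (forall y, `|kap y| <= maj_ker T B p.1 p.2 y) ->
  (forall q, (`|g q|%:E <= G q)%E) ->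
  (@leb6 R).-integrable setT (fun y => (kap y * g (retard_point (p, y)))%:E).
Proof.
move=> Pfin mkap mg kap_le g_le.
have mgr : measurable_fun setT (fun y : X6 => g (retard_point (p, y))).
  apply: (measurableT_comp mg).
  apply: (measurableT_comp measurable_retard_point); exact: pair1_measurable.
have mkg : measurable_fun setT (fun y => kap y * g (retard_point (p, y))).
  exact: measurable_fun_mul.
apply/integrableP; split; first exact/measurable_EFinP.
apply: le_lt_trans Pfin.
apply: mnn_integral_le => [||y].
- apply: (mnn_EFin (f := fun y => `|kap y * g (retard_point (p, y))|)) => //.
  exact: measurableT_comp.
- exact: (mnn_pair1 p (mnn_maj_integrand T B_ge0 mG)).
- by rewrite /= normrM EFinM; apply: lee_pmul; rewrite ?lee_fin//.
Qed.

(** Replacing [U] by [fine U] changes nothing where the kernel vanishes. Where it is positive, an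
    infinite value of [U] would make the majorant integrand infinite, which a finite [maj_op] allows
    only on a null set. *)
Let kernel_opE i p :
  (maj_op T B G p < +oo)%E ->
  kernel_op (@leb6 R) sign_kernel retard_point U i p =
  (\int[leb6]_y (\sum_j sign_kernel i j (p, y)
      * fine (U j (retard_point (p, y))))%:E)%E.
Proof.
move=> Pfin.
have mI := mnn_pair1 p (mnn_kernel_integrand mK K0 measurable_retard_point i mU).
have mP := mnn_pair1 p (mnn_maj_integrand T B_ge0 mG).
have := mnn_integral_lty (m := @leb6 R) mP Pfin.
move=> Pae; apply: (@ae_eq_integral _ _ _ (@leb6 R)) => //.
- exact: mI.1.
- apply/measurable_EFinP; apply: measurable_sum => j; apply: measurable_fun_mul.
    by apply: measurableT_comp; [exact: mK|exact: pair1_measurable].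
  apply: (measurableT_comp (mfU j)).
  apply: (measurableT_comp measurable_retard_point); exact: pair1_measurable.
apply: (ae_imp (m := @leb6 R)) Pae => y /= Py _.
rewrite -sumEFin; apply: eq_bigr => j _; rewrite EFinM.
have Kj : sign_kernel i j (p, y) <= maj_ker T B p.1 p.2 y.
  by apply: le_trans (Kmaj j (p, y)); rewrite (bigD1 i)//= lerDl sumr_ge0.
have [K_eq0|K_neq0] := eqVneq (sign_kernel i j (p, y)) 0.
  by rewrite K_eq0 !mul0e.
have Kgt0 : 0 < sign_kernel i j (p, y) by rewrite lt_neqAle eq_sym K_neq0 K0.
rewrite fineK// ge0_fin_numE; last exact: (mU j).2.
rewrite ltNge leye_eq; apply/negP => /eqP Uoo.
have Goo : G (retard_point (p, y)) = +oo%E.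
  by apply/eqP; rewrite -leye_eq -Uoo; exact: U_le_G.
move: Py; rewrite -/(retard_point (p, y)) Goo gt0_muley ?ltxx//.
by rewrite lte_fin (lt_le_trans Kgt0).
Qed.

(** Where everything is finite, the equations of the positive and negative parts can be subtracted.
    Integrability is stated for any dominated [kap] because it is needed for the kernel before
    coupling, whose parts are not entries of the system. *)
Lemma signed_fixpointE e : in_square T e -> {ae leb6, forall x,
  (forall (kap : X6 -> R) i, measurable_fun setT kap ->
     (forall y, `|kap y| <= maj_ker T B e x y) ->
     (@leb6 R).-integrable setT
       (fun y => (kap y * signed_fixpoint i (retard_point ((e, x), y)))%:E)) /\
  (forall i, ((signed_fixpoint i (e, x))%:E = (phi0 i (e, x))%:E + \int[leb6]_y
    (\sum_j k i j ((e, x), y) * signed_fixpoint j (retard_point ((e, x), y)))%:E)%E)}.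
Proof.
move=> eQ; have [M' HM] := G_bound; have [HG HP] := HM e eQ.
have mP : mnn (maj_op T B G) by exact: mnn_maj_op.
apply: (ae_imp2 (m := @leb6 R) _ (sqnorm_lty mG HG) (sqnorm_lty mP HP)).
move=> x Gfin Pfin; split=> [kap i mkap kap_le|i].
  apply: (integrable_maj (p := (e, x)) Pfin mkap (measurable_signed_fixpoint i) kap_le).
  move=> q; apply: le_trans (sum_signed_le q).
  by rewrite lee_fin (bigD1 i)//= lerDl sumr_ge0.
pose N (j : J) := kernel_op (@leb6 R) sign_kernel retard_point U j (e, x).
have UE j : U j (e, x) = (sign_datum j (e, x) + N j)%E.
  by exact: (fixpointE (@leb6 R) mK K0 measurable_retard_point mU0 j (e, x)).
have Ufin j : U j (e, x) \is a fin_num.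
  by rewrite ge0_fin_numE; [exact: le_lt_trans (U_le_G j _) Gfin|exact: (mU j).2].
pose S j y := \sum_l sign_kernel j l ((e, x), y) * fine (U l (retard_point ((e, x), y))).
have NE j : N j = (\int[leb6]_y (S j y)%:E)%E by exact: kernel_opE.
have iS j : (@leb6 R).-integrable setT (fun y => (S j y)%:E).
  rewrite (_ : (fun y => (S j y)%:E) = (fun y => \sum_l
    (sign_kernel j l ((e, x), y) * fine (U l (retard_point ((e, x), y))))%:E)%E); last first.
    by apply/funext => y; rewrite sumEFin.
  apply: integrable_sum => // l _.
  apply: (@integrable_maj (e, x) (fun y => sign_kernel j l ((e, x), y))
    (fun q => fine (U l q)) Pfin).
  - by apply: measurableT_comp; [exact: mK|exact: pair1_measurable].
  - exact: mfU.
  - move=> y; rewrite ger0_norm//; apply: le_trans (Kmaj l ((e, x), y)).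
    by rewrite (bigD1 j)//= lerDl sumr_ge0.
  - move=> q; rewrite ger0_norm//; apply: le_trans (U_le_G l q).
    by apply: fine_le; exact: (mU l).2.
have Nfin j : N j \is a fin_num by rewrite NE; exact: integrable_fin_num.
have fE j : fine (U j (e, x)) = sign_part j.2 (phi0 j.1 (e, x)) + fine (N j).
  by rewrite UE fineD.
rewrite /signed_fixpoint !fE /= opprD addrACA sign_partB EFinD; congr (_ + _)%E.
rewrite EFinB !fineK// !NE -(integralB_EFin (mu := @leb6 R) measurableT (iS _) (iS _)).
apply: eq_integral => y _; rewrite -EFinB; congr _%:E.
(* The identity is (k+ U+ + k- U-) - (k- U+ + k+ U-) = (k+ - k-)(U+ - U-). *)
rewrite /S -sumrB sum_sign; apply: eq_bigr => j _.
rewrite /sign_kernel /signed_fixpoint /= -[X in _ = X * _]sign_partB /sign_part; ring.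
Qed.

End signed_system.

(** * Real and imaginary parts *)

Section complex_parts.
Context {R : realType}.

(** Booleans index the two parts so that a complex equation becomes a system over the finite type
    [bool]. *)
Definition part (c : bool) (z : R[i]) : R :=
  if c then complex.Re z else complex.Im z.

(** This l^1 modulus matches the sum over components used for systems; its square lies between that
    of [cmod] and twice that. *)
Definition abs1 (z : R[i]) : R := `|part true z| + `|part false z|.

Lemma complex_ext (z w : R[i]) : (forall c, part c z = part c w) -> z = w.
Proof.
case: z w => [a b] [c d] h.
by have := h true; have := h false; rewrite /part /= => -> ->.
Qed.

Lemma partD c (z w : R[i]) : part c (z + w) = part c z + part c w.
Proof. by rewrite /part; case: c; case: z => ? ?; case: w => ? ?. Qed.

Lemma partM_real c (r : R) (z : R[i]) : part c (r%:C%C * z) = r * part c z.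
Proof. by rewrite /part; case: c; case: z => ? ? /=; rewrite mul0r ?subr0 ?addr0. Qed.

Lemma partM (z w : R[i]) :
  (part true (z * w) = part true z * part true w - part false z * part false w) *
  (part false (z * w) = part true z * part false w + part false z * part true w).
Proof. by case: z => ? ?; case: w => ? ?. Qed.

Lemma part_le_cmod c (z : R[i]) : `|part c z| <= cmod z.
Proof.
rewrite /cmod -sqrtr_sqr ler_wsqrtr// /part.
by case: c; rewrite ?lerDl ?lerDr sqr_ge0.
Qed.

Lemma cmod_ge0 (z : R[i]) : 0 <= cmod z. Proof. exact: sqrtr_ge0. Qed.

Lemma cmod_sqr (z : R[i]) : cmod z ^+ 2 = part true z ^+ 2 + part false z ^+ 2.
Proof. by rewrite /cmod sqr_sqrtr// addr_ge0// sqr_ge0. Qed.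

Lemma cmod_sqr_le (z : R[i]) : cmod z ^+ 2 <= abs1 z * abs1 z.
Proof.
rewrite cmod_sqr /abs1 -(real_normK (num_real (part true z))).
rewrite -(real_normK (num_real (part false z))).
have := normr_ge0 (part true z); have := normr_ge0 (part false z); nra.
Qed.

Lemma abs1_sqr_le (z : R[i]) : abs1 z * abs1 z <= 2 * cmod z ^+ 2.
Proof.
rewrite cmod_sqr /abs1 -(real_normK (num_real (part true z))).
rewrite -(real_normK (num_real (part false z))).
have := sqr_ge0 (`|part true z| - `|part false z|); nra.
Qed.

Lemma div_real (z : R[i]) (r : R) : (z / r%:C)%C = (r^-1)%:C%C * z.
Proof. by rewrite mulrC fmorphV. Qed.

End complex_parts.

Arguments part : simpl never.

(** * The integral kernel in real components *)

Section components.
Context {R : realType}.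
Notation R3 := (@R3 R).
Notation E := (R * R)%type.
Notation X6 := (R3 * R3)%type.
Notation fn4 := (@fn4 R).
Variables (T : R) (a : R -> R) (f : fn4) (lam : R[i]).
Hypothesis T_gt0 : 0 < T.
Hypothesis a_cont : {within `[0, +oo[, continuous a}.
Hypothesis a_0 : a 0 = 0.
Hypothesis a_gt0 : forall eta : R, 0 < eta -> 0 < a eta.
Variable Mf : R.
Hypothesis f_bound : forall (e1 : R) (x1 : R3) (e2 : R) (x2 : R3),
  0 <= e1 -> 0 <= e2 -> cmod (f e1 x1 e2 x2) <= Mf.
Hypothesis f_meas : cmeasurable
  (((`[0, +oo[ : set R) `*` (`[0, +oo[ : set R)) `*` [set: X6]) (uncurry4 f).

(** Membership in B_3 gives measurability over [0,T]^2 only; the cut-off turns the weighted function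
    into one that is measurable on the whole space. *)
Definition wpart (g : fn4) (c : bool) (q : E * X6) : R :=
  if in_square T q.1 then part c (uncurry4 (weighted a g) q) else 0.

Lemma in_square_itv (e : E) : in_square T e -> e.1 \in `[0, T] /\ e.2 \in `[0, T].
Proof.
by move=> /andP[/andP[? ?] /andP[? ?]]; rewrite !in_itv/=; split; apply/andP; split => //; exact: ltW.
Qed.

Lemma measurable_wpart g c :
  cmeasurable ((`[0, T] `*` `[0, T]) `*` setT) (uncurry4 (weighted a g)) ->
  measurable_fun setT (wpart g c).
Proof.
move=> [mr mi]; pose D : set (E * X6) := (`[0, T] `*` `[0, T]) `*` setT.
have mD : measurable D by apply: measurableX => //; apply: measurableX.
have mF : measurable_fun D (fun q => part c (uncurry4 (weighted a g) q)).
  by rewrite /part; case: c.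
have mFD := (measurable_restrictT _ mD).1 mF.
rewrite (_ : wpart g c = fun q => if in_square T q.1 then
    ((fun q => part c (uncurry4 (weighted a g) q)) \_ D) q else 0).
  by mfun.
apply/funext => q; rewrite /wpart; case: ifPn => // qT.
rewrite patchE mem_set//; have [h1 h2] := in_square_itv qT.
by split=> //; split.
Qed.

(** Nothing is assumed about [a] at negative arguments; extension by 0 gives a function measurable
    on the line. [fpos] does the same for [f]. *)
Let apos (t : R) : R := (a \_ `[0, +oo[) t.

Let measurable_apos : measurable_fun setT apos.
Proof.
apply/(measurable_restrictT _ _).1; first exact: measurable_itv.
by apply: subspace_continuous_measurable_fun => //; exact: measurable_itv.
Qed.

Let aposE t : 0 <= t -> apos t = a t.
Proof. by move=> t0; rewrite /apos patchE mem_set//= in_itv/= t0. Qed.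

Let fpos (c : bool) (q : E * X6) : R :=
  ((fun q => part c (uncurry4 f q)) \_ ((`[0, +oo[ `*` `[0, +oo[) `*` setT)) q.

Let measurable_fpos c : measurable_fun setT (fpos c).
Proof.
apply/(measurable_restrictT _ _).1.
  by apply: measurableX => //; apply: measurableX; exact: measurable_itv.
by rewrite /part; case: c; case: f_meas.
Qed.

Let fposE c q : 0 <= q.1.1 -> 0 <= q.1.2 -> fpos c q = part c (uncurry4 f q).
Proof.
move=> q1 q2; rewrite /fpos patchE mem_set//; split=> //.
by split; rewrite /= in_itv/= andbT.
Qed.

(** Each [a] occurs to the first power, the second power being part of [wpart]. *)
Definition ker (c : bool) (q : (E * X6) * X6) : R :=
  let s := retard q.1.1 (sub6 q.1.2 q.2) in
  if in_square T q.1.1 && in_square T s then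
    apos s.1 * apos s.2 * ((norm3 (sub3 q.1.2.1 q.2.1))^-1
      * (norm3 (sub3 q.1.2.2 q.2.2))^-1 * (norm3 (sub3 q.2.1 q.2.2))^-1)
      * fpos c (s, q.2)
  else 0.

Lemma measurable_ker c : measurable_fun setT (ker c).
Proof.
rewrite /ker /=.
have ms : measurable_fun setT (fun q : (E * X6) * X6 => retard q.1.1 (sub6 q.1.2 q.2)).
  by mfun.
have m1 : measurable_fun setT (fun q : (E * X6) * X6 =>
    apos (q.1.1.1 - norm3 (sub3 q.1.2.1 q.2.1))).
  by apply: (measurableT_comp measurable_apos); mfun.
have m2 : measurable_fun setT (fun q : (E * X6) * X6 =>
    apos (q.1.1.2 - norm3 (sub3 q.1.2.2 q.2.2))).
  by apply: (measurableT_comp measurable_apos); mfun.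
have m3 : measurable_fun setT (fun q : (E * X6) * X6 =>
    fpos c (retard q.1.1 (sub6 q.1.2 q.2), q.2)).
  by apply: (measurableT_comp (measurable_fpos c)); mfun.
by mfun.
Qed.

Lemma a_bounded : exists2 C : R, 0 <= C & forall t, 0 < t -> t <= T -> `|a t| <= C.
Proof.
have ca : {within `[0, T], continuous (fun t => `|a t|)}.
  have ca : {within `[0, T], continuous a}.
    by apply: continuous_subspaceW a_cont => t /=; rewrite !in_itv/= => /andP[->].
  by move=> t; apply: continuous_comp; [exact: ca|exact: norm_continuous].
have [c _ cmax] := EVT_max (ltW T_gt0) ca.
exists `|a c| => // t t0 tT; apply: cmax; rewrite in_itv/= tT ltW//.
Qed.

Lemma ker_le : exists2 B : R, 0 <= B & forall q,
  `|ker true q| + `|ker false q| <= maj_ker T B q.1.1 q.1.2 q.2.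
Proof.
have [C C0 aC] := a_bounded; have Mf0 : 0 <= Mf.
  exact: le_trans (cmod_ge0 _) (f_bound (0, 0, 0) (0, 0, 0) (lexx 0) (lexx 0)).
exists (C * C * (Mf + Mf)); first by rewrite !mulr_ge0 ?addr_ge0.
move=> q; rewrite /ker /maj_ker; case: ifPn => [/andP[_ sQ]|_]; last first.
  by rewrite normr0 addr0.
set s := retard _ _ in sQ *; have /andP[/andP[s1 s1T] /andP[s2 s2T]] := sQ.
set r := (_^-1 * _^-1 * _^-1).
have r0 : 0 <= r by rewrite !mulr_ge0 ?invr_ge0 ?norm3_ge0.
rewrite !aposE ?(ltW s1) ?(ltW s2)// !fposE ?(ltW s1) ?(ltW s2)//.
have nE (r' z : R) : 0 <= r' ->
    `|a s.1 * a s.2 * r' * z| = `|a s.1| * `|a s.2| * r' * `|z|.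
  by move=> r'0; rewrite !normrM (ger0_norm r'0).
rewrite !nE// -mulrDr [leRHS]mulrAC.
apply: ler_pM.
- by rewrite mulr_ge0// mulr_ge0.
- exact: addr_ge0.
- by apply: ler_pM => //; apply: ler_pM => //; exact: aC.
by apply: lerD; apply: le_trans (part_le_cmod _ _) _; apply: f_bound; exact: ltW.
Qed.

Lemma part_integrand g e x y c : in_square T e ->
  part c (integrand a f g e.1 x.1 e.2 x.2 y) =
  (if c then ker true ((e, x), y) * wpart g true (retard_point ((e, x), y))
             - ker false ((e, x), y) * wpart g false (retard_point ((e, x), y))
   else ker true ((e, x), y) * wpart g false (retard_point ((e, x), y))
             + ker false ((e, x), y) * wpart g true (retard_point ((e, x), y))).
Proof.
move=> eQ; rewrite /integrand /Ktilde !dist3E div_real -mulrA partM_real.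
rewrite /ker /wpart /= eQ /=.
set s := retard e (sub6 x y); set r1 := norm3 (sub3 x.1 y.1).
set r2 := norm3 (sub3 x.2 y.2).
have s1E : e.1 - r1 = s.1 by []; have s2E : e.2 - r2 = s.2 by [].
rewrite s1E s2E; have [sQ|sQ] := boolP (in_square T s); last first.
  suff -> : a s.1 ^+ 2 * a s.2 ^+ 2 * (heaviside s.1 / r1) * (heaviside s.2 / r2) = 0.
    by rewrite !mul0r; case: c; rewrite ?subr0 ?addr0.
  have sT (i : bool) : (if i then s.1 else s.2) <= T.
    have /andP[/andP[_ e1] /andP[_ e2]] := eQ.
    by case: i; [apply: le_trans e1|apply: le_trans e2]; rewrite /s /= gerBl norm3_ge0.
  (* For t < 0 the Heaviside factor vanishes; at t = 0 it is 1, and a(0) = 0 takes over. *)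
  have z (t : R) : t <= 0 -> a t * heaviside t = 0.
    rewrite le_eqVlt => /predU1P[->|t0]; first by rewrite a_0 mul0r.
    by rewrite /heaviside leNgt t0 mulr0.
  have [s1|s1] := leP s.1 0.
    rewrite (_ : _ * _ = (a s.1 * heaviside s.1)
      * (a s.1 * (a s.2 ^+ 2 * (r1^-1 * (heaviside s.2 / r2))))); last by ring.
    by rewrite z// mul0r.
  have [s2|s2] := leP s.2 0.
    rewrite (_ : _ * _ = (a s.2 * heaviside s.2)
      * (a s.2 * (a s.1 ^+ 2 * (r2^-1 * (heaviside s.1 / r1))))); last by ring.
    by rewrite z// mul0r.
  by move: sQ; rewrite /in_square s1 s2 (sT true) (sT false).
have /andP[/andP[s1 _] /andP[s2 _]] := sQ.
rewrite /heaviside !ltW// !aposE ?ltW// !fposE ?ltW//.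
rewrite /uncurry4 /weighted /= !partM_real.
rewrite -[X in part c X]mulrA partM_real.
by case: c; rewrite !partM; ring.
Qed.

End components.

(** * The complex equation as a real 2 x 2 system *)

Section real_system.
Context {R : realType}.
Notation R3 := (@R3 R).
Notation E := (R * R)%type.
Notation X6 := (R3 * R3)%type.
Notation fn4 := (@fn4 R).
Variables (T : R) (a : R -> R) (f : fn4) (lam : R[i]).
Hypothesis T_gt0 : 0 < T.
Hypothesis a_cont : {within `[0, +oo[, continuous a}.
Hypothesis a_0 : a 0 = 0.
Hypothesis a_gt0 : forall eta : R, 0 < eta -> 0 < a eta.
Variable Mf : R.
Hypothesis f_bound : forall (e1 : R) (x1 : R3) (e2 : R) (x2 : R3),
  0 <= e1 -> 0 <= e2 -> cmod (f e1 x1 e2 x2) <= Mf.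
Hypothesis f_meas : cmeasurable
  (((`[0, +oo[ : set R) `*` (`[0, +oo[ : set R)) `*` [set: X6]) (uncurry4 f).

Definition coupling : R[i] := lam * (((4 * pi) ^+ 2)^-1)%:C%C.

(* Multiplication by [coupling] times the kernel, as a real 2 x 2 matrix. *)
Definition sysker (i j : bool) (q : (E * X6) * X6) : R :=
  let re := part true coupling * ker T a f true q
            - part false coupling * ker T a f false q in
  let im := part true coupling * ker T a f false q
            + part false coupling * ker T a f true q in
  if i then (if j then re else - im) else (if j then im else re).

Lemma measurable_sysker i j : measurable_fun setT (sysker i j).
Proof.
have m c := measurable_ker T a_cont f_meas c.
have mre : measurable_fun setT (fun q => part true coupling * ker T a f true q
    - part false coupling * ker T a f false q).
  by have := m true; have := m false => mt mf; mfun.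
have mim : measurable_fun setT (fun q => part true coupling * ker T a f false q
    + part false coupling * ker T a f true q).
  by have := m true; have := m false => mt mf; mfun.
by rewrite /sysker; case: i; case: j => //; exact: measurable_funN.
Qed.

Lemma maj_kerZ B t e x y : maj_ker T (t * B) e x y = t * maj_ker T B e x y.
Proof. by rewrite /maj_ker; case: ifP => _; rewrite ?mulr0// mulrA. Qed.

(** The 1 added to the size of the coupling lets the same [B] dominate [ker] itself, even for [lam]
    = 0: integrability of the integrand is part of being a solution and does not see [lam]. *)
Lemma sysker_le : exists2 B : R, 0 <= B &
  (forall j q, \sum_i `|sysker i j q| <= maj_ker T B q.1.1 q.1.2 q.2) /\
  (forall c q, `|ker T a f c q| <= maj_ker T B q.1.1 q.1.2 q.2).
Proof.
have [B B0 kB] := ker_le T_gt0 a_cont f_bound.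
exists ((abs1 coupling + 1) * B).
  by rewrite mulr_ge0// addr_ge0// addr_ge0.
split=> [j|c] q; rewrite maj_kerZ; have := kB q; have := maj_ker_ge0 T B0 q.1.1 q.1.2 q.2;
  set m := maj_ker _ _ _ _ _ => m0 kq; last first.
  have kc : `|ker T a f c q| <= m.
    by apply: le_trans kq; case: c; rewrite ?lerDl ?lerDr.
  rewrite mulrDl mul1r; apply: (le_trans kc); rewrite lerDr mulr_ge0//.
  exact: addr_ge0.
set cr := part true coupling; set ci := part false coupling.
set kr := ker T a f true q in kq *; set ki := ker T a f false q in kq *.
have h1 : `|cr * kr - ci * ki| <= `|cr| * `|kr| + `|ci| * `|ki|.
  by rewrite (le_trans (ler_normB _ _))// !normrM.
have h2 : `|cr * ki + ci * kr| <= `|cr| * `|ki| + `|ci| * `|kr|.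
  by rewrite (le_trans (ler_normD _ _))// !normrM.
have h3 : (`|cr| + `|ci|) * (`|kr| + `|ki|) <= (abs1 coupling + 1) * m.
  apply: ler_pM => //.
  by rewrite /abs1 lerDl.
rewrite big_bool /sysker -/cr -/ci -/kr -/ki.
apply: le_trans h3; rewrite mulrDl !mulrDr.
by case: j => /=; rewrite ?normrN; lra.
Qed.

Section at_point.
Variables (psi : fn4) (e : E) (x : X6).
Hypothesis eQ : in_square T e.

Let F := integrand a f psi e.1 x.1 e.2 x.2.
Let W (j : bool) (y : X6) := wpart T a psi j (retard_point ((e, x), y)).

Lemma sysker_sumE i y : \sum_j sysker i j ((e, x), y) * W j y =
  if i then part true coupling * part true (F y) - part false coupling * part false (F y)
  else part true coupling * part false (F y) + part false coupling * part true (F y).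
Proof.
rewrite big_bool /= /F !(part_integrand f a_0 psi x y _ eQ) /sysker /W.
by case: i; cbv beta iota zeta; ring.
Qed.

Lemma integral_sysker : cintegrable leb6 F -> forall i,
  (@leb6 R).-integrable setT
    (fun y => (\sum_j sysker i j ((e, x), y) * W j y)%:E) /\
  (part i (coupling * cintegral leb6 F))%:E =
    (\int[leb6]_y (\sum_j sysker i j ((e, x), y) * W j y)%:E)%E.
Proof.
move=> iF i.
have iFp b : (@leb6 R).-integrable setT (fun y => (part b (F y))%:E).
  by case: b; case: iF.
have Ip b : (part b (cintegral leb6 F))%:E = (\int[leb6]_y (part b (F y))%:E)%E.
  have fin : (\int[leb6]_y (part b (F y))%:E)%E \is a fin_num.
    exact: (integrable_fin_num (mu := @leb6 R)).
  by move: fin; case: b => fin; rewrite /part /= fineK.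
have iZ (r : R) b : (@leb6 R).-integrable setT (fun y => (r * part b (F y))%:E).
  by apply: (integrableZl (mu := @leb6 R) measurableT r (iFp b)).
have IZ (r : R) b : (\int[leb6]_y (r * part b (F y))%:E)%E
    = (r * part b (cintegral leb6 F))%:E.
  by rewrite EFinM Ip -(integralZl (mu := @leb6 R) measurableT (iFp b)).
under eq_fun do rewrite sysker_sumE.
case: i; split.
- exact: (integrableB (mu := @leb6 R) measurableT (iZ _ _) (iZ _ _)).
- rewrite partM (integralB_EFin (mu := @leb6 R) measurableT (iZ _ _) (iZ _ _)).
  by rewrite !IZ.
- exact: (integrableD (mu := @leb6 R) measurableT (iZ _ _) (iZ _ _)).
- rewrite partM (integralD_EFin (mu := @leb6 R) measurableT (iZ _ _) (iZ _ _)).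
  by rewrite !IZ.
Qed.

Lemma cintegrable_integrand :
  (forall c j, (@leb6 R).-integrable setT
     (fun y => (ker T a f c ((e, x), y) * W j y)%:E)) ->
  cintegrable leb6 F.
Proof.
move=> ik; split.
- rewrite (_ : (fun y => _) = (fun y => (ker T a f true ((e, x), y) * W true y
      - ker T a f false ((e, x), y) * W false y)%:E)).
    exact: (integrableB (mu := @leb6 R) measurableT (ik _ _) (ik _ _)).
  by apply/funext => y; rewrite -/(part true _) (part_integrand f a_0 psi x y _ eQ).
- rewrite (_ : (fun y => _) = (fun y => (ker T a f true ((e, x), y) * W false y
      + ker T a f false ((e, x), y) * W true y)%:E)).
    exact: (integrableD (mu := @leb6 R) measurableT (ik _ _) (ik _ _)).
  by apply/funext => y; rewrite -/(part false _) (part_integrand f a_0 psi x y _ eQ).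
Qed.

Lemma equation_parts (psifree : fn4) (z : R[i]) :
  (psi e.1 x.1 e.2 x.2 = psifree e.1 x.1 e.2 x.2
      + lam * (((4 * pi) ^+ 2)^-1 * (a e.1 * a e.2)^-1)%:C * z)%C <->
  (forall i, wpart T a psi i (e, x) = wpart T a psifree i (e, x)
      + part i (coupling * z)).
Proof.
have /andP[/andP[e1 _] /andP[e2 _]] := eQ.
have aa : a e.1 * a e.2 != 0 by rewrite gt_eqF// mulr_gt0// a_gt0.
have E1 : lam * (((4 * pi) ^+ 2)^-1 * (a e.1 * a e.2)^-1)%:C%C * z =
    ((a e.1 * a e.2)^-1)%:C%C * (coupling * z).
  by rewrite /coupling rmorphM /=; ring.
have WE g i : wpart T a g i (e, x) = a e.1 * a e.2 * part i (g e.1 x.1 e.2 x.2).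
  by rewrite /wpart /= eQ /uncurry4 /weighted /= partM_real.
split=> [h i|h].
  rewrite !WE h E1 partD partM_real mulrDr; congr (_ + _).
  by rewrite mulrA divff// mul1r.
apply: complex_ext => i; rewrite E1 partD partM_real.
apply: (mulfI aa); rewrite -WE h WE mulrDr; congr (_ + _).
by rewrite mulrA divff// mul1r.
Qed.

End at_point.

Lemma ae_in_square : {ae @leb2 R, forall e, e.1 \in `[0, T] -> e.2 \in `[0, T] ->
  in_square T e}.
Proof.
pose O : set R := [set 0].
have mO : measurable O by exact: measurable_set1.
have mT : measurable [set: R] by exact: measurableT.
exists ((O `*` setT) `|` (setT `*` O)); split.
- by apply: measurableU; exact: measurableX.
- have z1 : @leb2 R (O `*` setT) = 0%E.
    transitivity (@lebesgue_measure R O * @lebesgue_measure R setT)%E.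
      exact: (product_measure1E (@lebesgue_measure R) (@lebesgue_measure R)).
    by rewrite lebesgue_measure_set1 mul0e.
  have z2 : @leb2 R (setT `*` O) = 0%E.
    transitivity (@lebesgue_measure R setT * @lebesgue_measure R O)%E.
      exact: (product_measure1E (@lebesgue_measure R) (@lebesgue_measure R)).
    by rewrite lebesgue_measure_set1 mule0.
  apply: (null_set_setU (mu := @leb2 R)) => //; exact: measurableX.
- move=> e /= he; apply: contrapT => hn; apply: he.
  rewrite !in_itv/= => /andP[e1 e1T] /andP[e2 e2T].
  rewrite /in_square e1T e2T !andbT !lt_neqAle e1 e2 !andbT.
  apply/andP; split; rewrite eq_sym; apply/eqP => h; apply: hn; [left|right]; split => //.
Qed.

(** The factor 2 is the price of passing from [cmod] to [abs1]; the absolute value makes the bound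
    nonnegative. *)
Lemma inB3_sqnorm (g : fn4) : inB3 T (weighted a g) -> exists2 M : R, 0 <= M &
  {ae @leb2 R, forall e, in_square T e ->
    (sqnorm (fun q => (\sum_i `|wpart T a g i q|)%:E) e <= M%:E)%E}.
Proof.
move=> [mg [M HM]]; exists (2 * `|M|); first by rewrite mulr_ge0.
have mw i := measurable_wpart i mg.
apply: (ae_imp (m := @leb2 R)) HM => e HM eQ.
have [i1 i2] := in_square_itv eQ; have {HM} := HM i1 i2 => HM.
have wE i x : wpart T a g i (e, x) = part i (weighted a g e.1 x.1 e.2 x.2).
  by rewrite /wpart /= eQ.
have m2 : mnn (fun x : X6 => ((cmod (weighted a g e.1 x.1 e.2 x.2)) ^+ 2)%:E).
  apply: mnn_EFin => [|x]; last exact: sqr_ge0.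
  rewrite (_ : (fun x : X6 => _) = (fun x => wpart T a g true (e, x) ^+ 2
      + wpart T a g false (e, x) ^+ 2)).
    have m3 i : measurable_fun setT (fun x : X6 => wpart T a g i (e, x)).
      by apply: measurableT_comp (mw i) _; exact: pair1_measurable.
    by apply: measurable_fun_add; apply: measurable_funX; exact: m3.
  by apply/funext => x; rewrite cmod_sqr !wE.
apply: (@le_trans _ _ (2%:E * `|M|%:E)%E); last by rewrite EFinM.
apply: (@le_trans _ _ (2%:E * \int[leb6]_x
    ((cmod (weighted a g e.1 x.1 e.2 x.2)) ^+ 2)%:E)%E); last first.
  apply: lee_wpmul2l; first by rewrite lee_fin.
  by apply: (le_trans HM); rewrite lee_fin ler_norm.
rewrite -(mnn_integralZl (@leb6 R) m2); last by rewrite lee_fin.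
apply: mnn_integral_le => [||x].
- have : mnn (fun q => (\sum_i `|wpart T a g i q|)%:E).
    apply: mnn_EFin => [|q]; last exact: sumr_ge0.
    by apply: measurable_sum => i; apply: measurableT_comp.
  by move=> /(mnn_pair1 e) m; exact: mnnM.
- by apply: mnnM => //; apply: mnn_cst; rewrite lee_fin.
- by rewrite -!EFinM lee_fin big_bool /= !wE; exact: abs1_sqr_le.
Qed.

End real_system.

(** * Existence and uniqueness *)

Section solution.
Context {R : realType}.
Notation R3 := (@R3 R).
Notation E := (R * R)%type.
Notation X6 := (R3 * R3)%type.
Notation fn4 := (@fn4 R).
Variables (T : R) (a : R -> R) (f : fn4) (lam : R[i]).
Hypothesis T_gt0 : 0 < T.
Hypothesis a_cont : {within `[0, +oo[, continuous a}.
Hypothesis a_0 : a 0 = 0.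
Hypothesis a_gt0 : forall eta : R, 0 < eta -> 0 < a eta.
Variable Mf : R.
Hypothesis f_bound : forall (e1 : R) (x1 : R3) (e2 : R) (x2 : R3),
  0 <= e1 -> 0 <= e2 -> cmod (f e1 x1 e2 x2) <= Mf.
Hypothesis f_meas : cmeasurable
  (((`[0, +oo[ : set R) `*` (`[0, +oo[ : set R)) `*` [set: X6]) (uncurry4 f).
Variable psifree : fn4.
Hypothesis psifree_B3 : inB3 T (weighted a psifree).

Let K := sysker T a f lam.

Let msys i j : measurable_fun setT (K i j).
Proof. exact: (measurable_sysker T lam a_cont f_meas i j). Qed.

Let in_square_neq0 e : in_square T e -> a e.1 * a e.2 != 0.
Proof.
by move=> /andP[/andP[e1 _] /andP[e2 _]]; rewrite gt_eqF// mulr_gt0// a_gt0.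
Qed.

Lemma solution_exists :
  exists psi : fn4, inB3 T (weighted a psi) /\ solves T lam a f psifree psi.
Proof.
have [B B0 [Kle kerle]] := sysker_le lam T_gt0 a_cont f_bound.
have [M M0 HM] := inB3_sqnorm psifree_B3.
have [mfree _] := psifree_B3.
have mw i := measurable_wpart i mfree.
pose N := fun q : E * X6 => (\sum_i `|wpart T a psifree i q|)%:E.
have mN : mnn N.
  apply: mnn_EFin => [|q]; last exact: sumr_ge0.
  by apply: measurable_sum => i; apply: measurableT_comp.
(* Discarding the exceptional times makes the datum bounded at every time. *)
pose C := [set q : E * X6 | (sqnorm N q.1 <= M%:E)%E].
have mC : measurable C.
  have ms : measurable_fun setT (fun q : E * X6 => sqnorm N q.1).
    by apply: (measurableT_comp (mnn_sqnorm mN).1).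
  by have := emeasurable_fun_infty_c measurableT ms M%:E; rewrite setTI.
pose phi0 i := (wpart T a psifree i) \_ C.
have mphi0 i : measurable_fun setT (phi0 i).
  apply: ((measurable_restrictT (wpart T a psifree i) mC).1 _).
  exact: (@measurable_funS _ _ _ _ setT C _ measurableT (@subsetT _ _) (mw i)).
have phi0E e x i : (sqnorm N e <= M%:E)%E -> phi0 i (e, x) = wpart T a psifree i (e, x).
  by move=> h; rewrite /phi0 patchE mem_set.
have phi0n e x i : ~~ (sqnorm N e <= M%:E)%E -> phi0 i (e, x) = 0.
  by move=> h; rewrite /phi0 patchE memNset//=; exact/negP.
have phi0_supp e x i : ~~ in_square T e -> phi0 i (e, x) = 0.
  move=> eQ; rewrite /phi0 patchE; case: ifP => // _.
  by rewrite /wpart /= (negbTE eQ).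
have phi0_bd e : in_square T e ->
    (sqnorm (fun q => (\sum_i `|phi0 i q|)%:E) e <= M%:E)%E.
  move=> eQ; have [h|h] := boolP (sqnorm N e <= M%:E)%E.
    apply: (le_trans _ h); rewrite le_eqVlt; apply/orP; left; apply/eqP.
    apply: eq_integral => x _; rewrite /N; congr (_%:E * _%:E)%E;
    by apply: eq_bigr => i _; rewrite phi0E//; exact: h.
  rewrite (_ : sqnorm _ _ = 0%E) ?lee_fin//; apply: integral0_eq => x _.
  by rewrite big1 ?mul0e// => i _; rewrite phi0n ?normr0.
pose phi := signed_fixpoint K phi0.
have mphi i : measurable_fun setT (phi i).
  exact: (measurable_signed_fixpoint msys mphi0 i).
have [M' HM'] := signed_fixpoint_bound T_gt0 B0 msys Kle mphi0 M0 phi0_supp phi0_bd.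
have phiE := signed_fixpointE T_gt0 B0 msys Kle mphi0 M0 phi0_supp phi0_bd.
pose psi : fn4 := fun e1 x1 e2 x2 => if in_square T (e1, e2) then
  (((a e1 * a e2)^-1)%:C * (phi true ((e1, e2), (x1, x2))
    +i* phi false ((e1, e2), (x1, x2))))%C else 0.
have wE q i : part i (uncurry4 (weighted a psi) q) =
    if in_square T q.1 then phi i q else 0.
  case: q => [[e1 e2] [x1 x2]]; rewrite /uncurry4 /weighted /psi /=.
  case: ifPn => [eQ|_]; last by rewrite mulr0; case: i.
  rewrite !partM_real mulrA divff ?mul1r; last exact: (in_square_neq0 eQ).
  by case: i.
have wpE q i : wpart T a psi i q = if in_square T q.1 then phi i q else 0.
  by rewrite /wpart wE; case: (in_square T q.1).
exists psi; split.
  split.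
    have mp i : measurable_fun setT (fun q => part i (uncurry4 (weighted a psi) q)).
      by under eq_fun do rewrite wE; have := mphi i => mi; mfun.
    by split; apply: measurable_funTS; [exact: (mp true)|exact: (mp false)].
  exists `|M'|; apply: (aeW (@leb2 R)) => e _ _.
  have mphie i : measurable_fun setT (fun x : X6 => phi i (e, x)).
    by apply: (measurableT_comp (mphi i)); exact: pair1_measurable.
  have m1 : mnn (fun x : X6 => ((cmod (weighted a psi e.1 x.1 e.2 x.2)) ^+ 2)%:E).
    apply: mnn_EFin => [|x]; last exact: sqr_ge0.
    rewrite (_ : (fun x : X6 => _) = (fun x : X6 => if in_square T e then
        phi true (e, x) ^+ 2 + phi false (e, x) ^+ 2 else 0)).
      have := mphie true; have := mphie false => mt mf.
      by case: (in_square T e); mfun.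
    apply/funext => x; rewrite cmod_sqr.
    have := wE (e, x) true; have := wE (e, x) false; rewrite /uncurry4 /= => -> ->.
    by case: ifP => // _; rewrite expr0n/= addr0.
  have [eQ|eQ] := boolP (in_square T e); last first.
    rewrite (_ : integral _ _ _ = 0%E) ?lee_fin//; apply: integral0_eq => x _.
    have := wE (e, x) true; have := wE (e, x) false; rewrite /uncurry4 /= (negbTE eQ).
    by rewrite cmod_sqr => -> ->; rewrite expr0n/= addr0.
  apply: (@le_trans _ _ M'%:E); last by rewrite lee_fin ler_norm.
  apply: le_trans (HM' e eQ).
  have mS : mnn (fun q => (\sum_i `|phi i q|)%:E).
    apply: mnn_EFin => [|q]; last exact: sumr_ge0.
    by apply: measurable_sum => i; apply: measurableT_comp.
  apply: mnn_integral_le => [||x]; first exact: m1.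
    by have := mnn_pair1 e mS => m; exact: mnnM.
  rewrite -EFinM lee_fin big_bool /=; apply: (le_trans (cmod_sqr_le _)).
  have := wE (e, x) true; have := wE (e, x) false; rewrite /uncurry4 /= eQ.
  by rewrite /abs1 => -> ->.
(* The truncated datum agrees with the original one at the non-exceptional times only, so the
   equation is claimed for those. *)
apply: (ae_imp2 (m := @leb2 R) _ (ae_in_square T) HM) => e eT eM e1 e2.
have eQ := eT e1 e2; have {}eM := eM eQ.
apply: (ae_imp (m := @leb6 R)) (phiE e eQ) => x [xint xeq].
have ker0 c y : ~~ in_square T (retard e (sub6 x y)) -> ker T a f c ((e, x), y) = 0.
  by move=> h; rewrite /ker /= (negbTE h) andbF.
(* [wpart] cuts [phi] off outside the square, but the kernel vanishes at exactly those retarded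
   times, so under the integral the two are interchangeable. *)
have kerw c j y : ker T a f c ((e, x), y) * wpart T a psi j (retard_point ((e, x), y)) =
    ker T a f c ((e, x), y) * phi j (retard_point ((e, x), y)).
  rewrite wpE /=; case: ifPn => // h; rewrite ker0 ?mul0r//; exact: h.
have cint : cintegrable leb6 (integrand a f psi e.1 x.1 e.2 x.2).
  apply: (cintegrable_integrand a_0 eQ) => c j.
  under eq_fun do rewrite kerw.
  apply: xint => [|y]; last exact: (kerle c ((e, x), y)).
  apply: (measurableT_comp (measurable_ker T a_cont f_meas c)).
  exact: pair1_measurable.
split=> //; apply/(equation_parts lam a_gt0 psi x eQ) => i.
rewrite [LHS]wpE /= eQ; apply: EFin_inj.
rewrite [RHS]EFinD (integral_sysker lam a_0 eQ cint i).2 -(phi0E e x i eM).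
rewrite [LHS]xeq; congr (_ + _)%E; apply: eq_integral => y _; congr _%:E.
apply: eq_bigr => j _; rewrite wpE /=; case: ifPn => // h.
rewrite /K /sysker !ker0; [|exact: h|exact: h].
by rewrite !mulr0 subr0 addr0 oppr0; case: i; case: j; rewrite !mul0r.
Qed.

(** The datum cancels in the difference, whose l^1 size is then a subsolution of the scalar
    majorant, and [maj_op_unique] makes it vanish. *)
Lemma solution_unique (psi1 psi2 : fn4) :
  inB3 T (weighted a psi1) -> solves T lam a f psifree psi1 ->
  inB3 T (weighted a psi2) -> solves T lam a f psifree psi2 ->
  {ae leb2, forall e : R * R, e.1 \in `[0, T] -> e.2 \in `[0, T] ->
    {ae leb6, forall x : R3 * R3,
      psi1 e.1 x.1 e.2 x.2 = psi2 e.1 x.1 e.2 x.2}}.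
Proof.
move=> b1 s1 b2 s2.
have [B B0 [Kle _]] := sysker_le lam T_gt0 a_cont f_bound.
have [M1 M10 HM1] := inB3_sqnorm b1; have [M2 M20 HM2] := inB3_sqnorm b2.
have mw1 i := measurable_wpart i b1.1; have mw2 i := measurable_wpart i b2.1.
pose d i q := wpart T a psi1 i q - wpart T a psi2 i q.
have md i : measurable_fun setT (d i) by exact: measurable_fun_sub.
pose N (g : bool -> E * X6 -> R) q := (\sum_i `|g i q|)%:E.
have mN g : (forall i, measurable_fun setT (g i)) -> mnn (N g).
  move=> mg; apply: mnn_EFin => [|q]; last exact: sumr_ge0.
  by apply: measurable_sum => i; apply: measurableT_comp.
have Dzero : {ae leb2, forall e, {ae leb6, forall x, N d (e, x) = 0%E}}.
  (* The bound 2 M1 + 2 M2 comes from [sqnormD_le] applied to the two solutions. *)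
  apply: (maj_op_unique (T := T) (B := B) (M := 2 * M1 + 2 * M2) T_gt0 B0 (mN d md)).
  - move=> e x eQ; rewrite /N big1// => i _.
    by rewrite /d /wpart /= (negbTE eQ) subrr normr0.
  - apply: (ae_imp2 (m := @leb2 R) _ HM1 HM2) => e h1 h2 eQ.
    apply: (@le_trans _ _ (sqnorm (fun q => N (wpart T a psi1) q + N (wpart T a psi2) q)%E e)).
      apply: sqnorm_le; [exact: mN|by apply: mnnD; exact: mN|].
      apply: (aeW (@leb6 R)) => x; rewrite /N -EFinD lee_fin -big_split/=.
      by apply: ler_sum => i _; exact: ler_normB.
    apply: (le_trans (sqnormD_le e (mN _ mw1) (mN _ mw2))).
    apply: (@le_trans _ _ (2%:E * M1%:E + 2%:E * M2%:E)%E); last first.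
      by rewrite -!EFinM -EFinD.
    by apply: leeD; apply: lee_wpmul2l; rewrite ?lee_fin//; [exact: h1|exact: h2].
  have s12 := ae_imp2 (m := @leb2 R) (fun e h1 h2 => conj h1 h2) s1 s2.
  apply: (ae_imp (m := @leb2 R)) s12 => e [h1 h2] eQ.
  have [i1 i2] := in_square_itv eQ.
  apply: (ae_imp2 (m := @leb6 R) _ (h1 i1 i2) (h2 i1 i2)) => x [c1 q1] [c2 q2].
  have {}q1 := (equation_parts lam a_gt0 psi1 x eQ _ _).1 q1.
  have {}q2 := (equation_parts lam a_gt0 psi2 x eQ _ _).1 q2.
  pose S (psi : fn4) i y := \sum_j K i j ((e, x), y)
    * wpart T a psi j (retard_point ((e, x), y)).
  have I1 i := integral_sysker lam a_0 eQ c1 i.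
  have I2 i := integral_sysker lam a_0 eQ c2 i.
  have mS12 i : measurable_fun setT (fun y => S psi1 i y - S psi2 i y).
    by apply: measurable_fun_sub; apply/measurable_EFinP;
      [exact: (measurable_int _ (I1 i).1)|exact: (measurable_int _ (I2 i).1)].
  have dle i : (`|d i (e, x)|%:E <= \int[leb6]_y `|S psi1 i y - S psi2 i y|%:E)%E.
    have -> : (`|d i (e, x)|%:E = `| \int[leb6]_y (S psi1 i y - S psi2 i y)%:E |)%E.
      rewrite (integralB_EFin (mu := @leb6 R) measurableT (I1 i).1 (I2 i).1).
      rewrite -(I1 i).2 -(I2 i).2 -EFinB /=; congr (`|_|%:E).
      by rewrite /d q1 q2; ring.
    apply: (le_abse_integral (@leb6 R) measurableT).
    by apply/measurable_EFinP; exact: mS12.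
  have mabs i : mnn (fun y => `|S psi1 i y - S psi2 i y|%:E).
    by apply: mnn_EFin => //; exact: measurableT_comp.
  rewrite /N -sumEFin; apply: (le_trans (lee_sum _ (fun i _ => dle i))).
  rewrite -(ge0_integral_sum (@leb6 R) measurableT); last 2 first.
    by move=> i; exact: (mabs i).1.
    by move=> i y _; exact: (mabs i).2.
  apply: mnn_integral_le => [||y].
  - exact: mnn_sum.
  - exact: (mnn_pair1 (e, x) (mnn_maj_integrand T B0 (mN d md))).
  - rewrite sumEFin -EFinM lee_fin.
    apply: (@le_trans _ _ (\sum_i \sum_j `|K i j ((e, x), y)|
        * `|d j (retard_point ((e, x), y))|)).
      apply: ler_sum => i _; rewrite /S -sumrB.
      under eq_bigr do rewrite -mulrBr.
      by apply: (le_trans (ler_norm_sum _ _ _)); apply: ler_sum => j _; rewrite normrM.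
    (* Summing over the outputs first leaves column sums of the kernel, which [Kle] bounds. *)
    rewrite exchange_big /= mulr_sumr; apply: ler_sum => j _.
    by rewrite -mulr_suml ler_wpM2r//; exact: (Kle j ((e, x), y)).
apply: (ae_imp2 (m := @leb2 R) _ (ae_in_square T) Dzero) => e eT eD e1 e2.
have eQ := eT e1 e2; apply: (ae_imp (m := @leb6 R)) eD => x /eqP.
rewrite /N eqe psumr_eq0// => /allP h; apply: complex_ext => i.
have := h i (mem_index_enum _); rewrite /= normr_eq0 subr_eq0 /wpart /= eQ.
rewrite /uncurry4 /weighted /= !partM_real => /eqP.
exact: (mulfI (in_square_neq0 eQ)).
Qed.

End solution.

Theorem theorem4p2 (R : realType) (T : R) (a : R -> R) (f : @fn4 R) (lam : R[i]) :
  0 < T ->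
  {within `[0, +oo[, continuous a} ->
  a 0 = 0 ->
  (forall eta : R, 0 < eta -> 0 < a eta) ->
  (exists M : R, forall (e1 : R) (x1 : R3) (e2 : R) (x2 : R3),
      0 <= e1 -> 0 <= e2 -> cmod (f e1 x1 e2 x2) <= M) ->
  cmeasurable (((`[0, +oo[ : set R) `*` (`[0, +oo[ : set R)) `*` [set: R3 * R3]) (uncurry4 f) ->
  forall psifree : fn4,
    inB3 T (weighted a psifree) ->
    (exists psi : fn4, inB3 T (weighted a psi) /\ solves T lam a f psifree psi) /\
    (forall psi1 psi2 : fn4,
        inB3 T (weighted a psi1) -> solves T lam a f psifree psi1 ->
        inB3 T (weighted a psi2) -> solves T lam a f psifree psi2 ->
        {ae leb2, forall e : R * R, e.1 \in `[0, T] -> e.2 \in `[0, T] ->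
          {ae leb6, forall x : R3 * R3,
             psi1 e.1 x.1 e.2 x.2 = psi2 e.1 x.1 e.2 x.2}}).
Proof.
move=> T_gt0 a_cont a_0 a_gt0 [Mf f_bound] f_meas psifree psifree_B3; split.
  exact: (solution_exists lam T_gt0 a_cont a_0 a_gt0 f_bound f_meas psifree_B3).
move=> psi1 psi2 b1 s1 b2 s2.
exact: (solution_unique T_gt0 a_cont a_0 a_gt0 f_bound b1 s1 b2 s2).
Qed.
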